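(* Let $X=(X_1,X_2,\ldots)\in\mathcal{L}$ with $\nu$, $\theta$, $K$ as in the definition of $\mathcal{L}$, and let $\mu$ be a random probability measure on $(S,\mathcal{B})$ such that, for each fixed $A\in\mathcal{B}$, $$\mu(A)\overset{a.s.}=\lim_n\frac1n\sum_{i=1}^n1_A(X_i)\overset{a.s.}=\lim_nP\bigl(X_{n+1}\in A\mid\mathcal{F}_n\bigr).$$ Define $D_1=\{p\in\mathcal{P}:p\text{ discrete}\}$, $D_2=\{p\in\mathcal{P}:p\text{ non-atomic}\}$, $D_3=\{p\in\mathcal{P}:p\ll\nu\}$. Then, for each $j\in\{1,2,3\}$, $P(\mu\in D_j)\in\{0,1\}$ and $$P(\mu\in D_j)=1\quad\Longleftrightarrow\quad K(x)\in D_j\text{ for }\nu\text{-almost all }x\in S.$$ In addition, $$\sup_{A\in\mathcal{B}}\bigl|P(X_{n+1}\in A\mid\mathcal{F}_n)-\mu(A)\bigr|\overset{a.s.}\longrightarrow0\quad\text{as }n\to\infty.$$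
   Context: $S$ is a Borel subset of a Polish space and $\mathcal{B}$ is its Borel $\sigma$-field. All random elements are defined on a probability space $(\Omega,\mathcal{A},P)$, and $\mathcal{F}_n=\sigma(X_1,\ldots,X_n)$. $\mathcal{P}$ is the set of all probability measures on $\mathcal{B}$, and $\mathcal{C}$ is the $\sigma$-field on $\mathcal{P}$ generated by the maps $p\mapsto p(A)$, $A\in\mathcal{B}$. A kernel on $(S,\mathcal{B})$ is a measurable map $K:(S,\mathcal{B})\to(\mathcal{P},\mathcal{C})$; $K(x)(A)$ is the value of $K(x)$ at $A$. A random probability measure on $(S,\mathcal{B})$ is a measurable map $(\Omega,\mathcal{A})\to(\mathcal{P},\mathcal{C})$. $K$ is a regular conditional distribution for $\nu\in\mathcal{P}$ given a sub-$\sigma$-field $\mathcal{G}\subset\mathcal{B}$ if $K(x)\in\mathcal{P}$ for each $x\in S$, $x\mapsto K(x)(A)$ is $\mathcal{G}$-measurable for each $A\in\mathcal{B}$, and $\nu(A\cap G)=\int_GK(x)(A)\,\nu(dx)$ for all $A\in\mathcal{B}$, $G\in\mathcal{G}$. $\mathcal{L}$ is the class of all sequences $X=(X_1,X_2,\ldots)$ of $S$-valued random variables for which there are $\nu\in\mathcal{P}$, a constant $\theta>0$ and a kernel $K$ which is a regular conditional distribution for $\nu$ given some sub-$\sigma$-field $\mathcal{G}\subset\mathcal{B}$, such that $X_1\sim\nu$ and $P(X_{n+1}\in\cdot\mid\mathcal{F}_n)=\frac{\theta\nu(\cdot)+\sum_{i=1}^nK(X_i)(\cdot)}{n+\theta}$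 a.s. for all $n\ge1$. Each $X\in\mathcal{L}$ is exchangeable, so a random probability measure $\mu$ as in the claim exists. In the last display of the claim, $P(X_{n+1}\in\cdot\mid\mathcal{F}_n)$ is the regular version given by this formula. *)

(* Defs.v *)
From HB Require Import structures.
From mathcomp Require Import all_boot all_order all_algebra.
From mathcomp Require Import all_classical all_reals all_analysis.
From mathcomp Require Import measurable_realfun.
Import Order.TTheory GRing.Theory Num.Theory.
Import numFieldNormedType.Exports.

Set Implicit Arguments.
Unset Strict Implicit.
Unset Printing Implicit Defensive.

Local Open Scope classical_set_scope.
Local Open Scope ring_scope.

Definition polish (R : realType) (T : topologicalType) : Prop :=
  (exists2 C : set T, countable C & dense C) /\
  exists (M : metricType R) (f : T -> M) (g : M -> T),
    [/\ cancel f g, cancel g f, continuous f, continuous g &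
        forall F : set_system M, ProperFilter F -> cauchy F ->
          exists x : M, F --> x].

(* Measurable types are pointed, so a base point [x0] of the nonempty set [S]
   has to be provided. The topology is the one induced by [T]. *)
Definition pointed_subspace (T : topologicalType) (S : set T) (x0 : S) : Type :=
  S.

HB.instance Definition _ (T : topologicalType) (S : set T) (x0 : S) :=
  Topological.copy (pointed_subspace x0) (set_type S).
HB.instance Definition _ (T : topologicalType) (S : set T) (x0 : S) :=
  isPointed.Build (pointed_subspace x0) x0.

Definition borel_space (T : topologicalType) (S : set T) (x0 : S) :
    measurableType (@open (pointed_subspace x0)).-sigma :=
  g_sigma_algebraType (@open (pointed_subspace x0)).

Section definitions.
Context (R : realType) (dO dS : measure_display).
Context (Omega : measurableType dO) (S : measurableType dS).
Local Open Scope ereal_scope.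

Definition measurable_wrt (T : Type) (F : set_system T) (f : T -> \bar R) :
    Prop :=
  forall B : set (\bar R), measurable B -> F (f @^-1` B).

(* [f] is a version of the conditional probability P(E | F). *)
Definition cond_prob (P : probability Omega R) (F : set_system Omega)
    (E : set Omega) (f : Omega -> \bar R) : Prop :=
  [/\ measurable_wrt F f, P.-integrable setT f &
      forall B, F B -> \int[P]_(w in B) f w = P (E `&` B)].

Definition sub_sigma_field (G : set_system S) : Prop :=
  sigma_algebra setT G /\ G `<=` measurable.

Definition reg_cond_distr (nu : probability S R) (G : set_system S)
    (K : S -> pprobability S R) : Prop :=
  forall A, measurable A ->
    measurable_wrt G (fun x => (K x : probability S R) A) /\
    forall B, G B ->
      nu (A `&` B) = \int[nu]_(x in B) (K x : probability S R) A.

(* Sequences are indexed from 0: [X i] is the (i+1)-st variable, so that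
   [history X n] is generated by the first [n] variables and [X n] is the one
   to be predicted from them. *)
Definition history (X : nat -> Omega -> S) (n : nat) : set_system Omega :=
  g_sigma_preimage (fun i : 'I_n => X i).

Definition predictive (nu : probability S R) (theta : R)
    (K : S -> pprobability S R) (X : nat -> Omega -> S) (n : nat) (w : Omega)
    (A : set S) : \bar R :=
  (theta%:E * nu A + \sum_(i < n) (K (X i w) : probability S R) A)
    * ((n%:R + theta)^-1)%:E.

(* Membership of [X] in the class L of kernel based Dirichlet sequences, as
   witnessed by [nu], [theta] and [K]. *)
Definition in_class_L (P : probability Omega R) (X : nat -> {RV P >-> S})
    (nu : probability S R) (theta : R) (K : {mfun S >-> pprobability S R}) :
    Prop :=
  [/\ (0 < theta)%R,
      exists2 G, sub_sigma_field G & reg_cond_distr nu G K,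
      forall A, measurable A -> distribution P (X 0%N) A = nu A &
      forall n, (1 <= n)%N -> forall A, measurable A ->
        cond_prob P (history X n) (X n @^-1` A)
          (fun w => predictive nu theta K X n w A)].

(* The two a.s. limits that characterize the random measure [mu]; the second
   one is required of arbitrary versions of the conditional probabilities. *)
Definition directing_measure (P : probability Omega R)
    (X : nat -> {RV P >-> S}) (mu : {RV P >-> pprobability S R}) : Prop :=
  forall A, measurable A ->
    {ae P, forall w,
      ((n%:R^-1 * \sum_(i < n) \1_A (X i w))%:E)%R @[n --> \oo]
        --> (mu w : probability S R) A} /\
    forall g : nat -> Omega -> \bar R,
      (forall n, (1 <= n)%N ->
        cond_prob P (history X n) (X n @^-1` A) (g n)) ->
      {ae P, forall w,
        g n w @[n --> \oo] --> (mu w : probability S R) A}.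

Definition discrete_prob : set (pprobability S R) :=
  [set p | exists C : set S,
     [/\ countable C, measurable C & (p : probability S R) C = 1]].

(* Borel probabilities on a Polish space: the atoms are the points of positive
   mass. *)
Definition nonatomic_prob : set (pprobability S R) :=
  [set p | forall x : S, (p : probability S R) [set x] = 0].

Definition abs_cont_prob (nu : probability S R) : set (pprobability S R) :=
  [set p | (p : probability S R) `<< nu].

End definitions.

Arguments discrete_prob {R dS S}.
Arguments nonatomic_prob {R dS S}.

(* Main.v *)
(* The random measures K(X_i) form a Blackwell-MacQueen urn. Only countable generation
   and separation of the Borel field of S matter. For C in the conditioning
   field G one has K(x)(C) = 1_C(x) for nu-almost every x, so the indicators of
   {X_i in C} form a two-colour Polya urn with parameter theta * nu(C), whose
   expectations are computed by a recursion on 0-1 words.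

   Total variation. Split S into finitely many cells by a generating family of
   sigma(K). A second moment bound for the cells already visited at time m (on
   average O(log m) of them, whatever the partition) and a first moment bound
   for the others make the expected total variation between the predictive
   laws at times m < n, seen on the cells, O(m^(-1/4)) uniformly in the
   partition. Once the cells separate K(X_1), ..., K(X_n), this controls the
   total variation between the predictive laws themselves. Summing along
   m = k^8, and using that consecutive k^8 have ratio tending to 1, the
   predictive laws are almost surely Cauchy in total variation, and their limit
   agrees with mu on a countable generating algebra.

   Zero-one law. A probability p is discrete, non-atomic or absolutely
   continuous when phi(p) = 1, 0 or 0, where phi(p) is the maximum of p over a
   sigma-ideal (countable sets, nu-null sets). Choosing one member of the ideal
   that is maximal for mu and all K(X_i) at once, phi(mu) is the limit of the
   averages of phi(K(X_i)). If phi(K) > e on a set C with nu(C) > 0, that limit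
   is at least e * mu(C), and mu(C) > 0 almost surely: the rising factorial
   moments of the urn give E[(1 - mu(C))^k] -> 0 as k grows. *)
Require Import Defs.
From HB Require Import structures.
From mathcomp Require Import all_boot all_order all_algebra.
From mathcomp Require Import all_classical all_reals all_analysis.
From mathcomp Require Import measurable_realfun.
From mathcomp Require Import ring lra.
Import Order.TTheory GRing.Theory Num.Theory.
Import numFieldNormedType.Exports.

Set Implicit Arguments.
Unset Strict Implicit.
Unset Printing Implicit Defensive.

Local Open Scope classical_set_scope.
Local Open Scope ring_scope.

(** * Two-colour urns *)

Section two_colour_urn.
Context (R : realType) (a theta : R).
Implicit Types (b : seq bool) (f g h : seq bool -> R).

(** Conditional probability that the letter after the word [b] is [true], in a Polya urn of initial
    weight [theta], of which [a] belongs to [true]. *)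
Definition urn_mean b : R := (a + (count id b)%:R) / ((size b)%:R + theta).

Definition urn_step f b : R :=
  urn_mean b * f (rcons b true) + (1 - urn_mean b) * f (rcons b false).

(** Expectation of [f] at the random word of length [n], integrating out the last letter first. As a
    finite recursion it makes the urn estimates algebraic; [expect_bits] ties it to actual
    integrals. *)
Fixpoint urn_expect n f : R :=
  if n is m.+1 then urn_expect m (urn_step f) else f [::].

Hypotheses (a0 : 0 <= a) (atheta : a <= theta) (theta0 : 0 < theta).

Let pos n : 0 < n%:R + theta :> R.
Proof. by rewrite ltr_wpDl. Qed.

Lemma urn_mean_ge0 b : 0 <= urn_mean b.
Proof. by rewrite divr_ge0 ?addr_ge0// ltW. Qed.

Lemma urn_mean_le1 b : urn_mean b <= 1.
Proof.
rewrite ler_pdivrMr// mul1r addrC lerD// ler_nat; exact: count_size.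
Qed.

Lemma le_urn_expect n f g : (forall b, size b = n -> f b <= g b) ->
  urn_expect n f <= urn_expect n g.
Proof.
elim: n f g => [|n IH] f g fg /=; first exact: fg.
apply: IH => b bn; rewrite lerD// ler_wpM2l ?urn_mean_ge0 ?subr_ge0 ?urn_mean_le1//;
  by apply: fg; rewrite size_rcons bn.
Qed.

Lemma eq_urn_expect n f g : (forall b, size b = n -> f b = g b) ->
  urn_expect n f = urn_expect n g.
Proof.
by move=> fg; apply/eqP; rewrite eq_le !le_urn_expect// => b bn; rewrite fg.
Qed.

Lemma urn_expectD n f g :
  urn_expect n (fun b => f b + g b) = urn_expect n f + urn_expect n g.
Proof.
elim: n f g => [//|n IH] f g /=; rewrite -IH.
by apply: eq_urn_expect => b _; rewrite /urn_step; ring.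
Qed.

Lemma urn_expectZ n (c : R) f :
  urn_expect n (fun b => c * f b) = c * urn_expect n f.
Proof.
elim: n f => [//|n IH] f /=; rewrite -IH.
by apply: eq_urn_expect => b _; rewrite /urn_step; ring.
Qed.

Lemma urn_expect_cst n (c : R) : urn_expect n (fun=> c) = c.
Proof.
elim: n => [//|n IH] /=; rewrite -[RHS]IH.
by apply: eq_urn_expect => b _; rewrite /urn_step; ring.
Qed.

Lemma urn_expect_sum (I : Type) (r : seq I) (F : I -> seq bool -> R) n :
  urn_expect n (fun b => \sum_(i <- r) F i b) = \sum_(i <- r) urn_expect n (F i).
Proof.
elim: r => [|i r IH].
  by rewrite big_nil -[RHS](urn_expect_cst n 0); apply: eq_urn_expect => b _; rewrite big_nil.
by rewrite big_cons -IH -urn_expectD; apply: eq_urn_expect => b _; rewrite big_cons.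
Qed.

(** Stochastic approximation form of the update: given [b], the increment has mean zero and is of
    order one over the time. *)
Lemma urn_mean_rcons b x : urn_mean (rcons b x) =
  urn_mean b + (x%:R - urn_mean b) / ((size b).+1%:R + theta).
Proof.
rewrite /urn_mean size_rcons -cats1 count_cat /= addn0 natrD -natr1.
have := pos (size b); have := pos (size b).+1; rewrite -natr1 => p1 p2.
case: x => /=; field; lra.
Qed.

Let takeE m n b x : (m <= n)%N -> size b = n -> take m (rcons b x) = take m b.
Proof. by move=> mn bn; rewrite -cats1 takel_cat// bn. Qed.

Lemma urn_expect_take m n f : (m <= n)%N ->
  urn_expect n (fun b => f (take m b)) = urn_expect m f.
Proof.
elim: n => [|n IH]; first by rewrite leqn0 => /eqP ->.
rewrite leq_eqVlt => /orP[/eqP ->|].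
  by apply: eq_urn_expect => b <-; rewrite take_size.
rewrite ltnS => mn; rewrite -IH//=; apply: eq_urn_expect => b bn.
by rewrite /urn_step !(takeE _ mn bn); ring.
Qed.

(** Martingale property of [urn_mean], tested against a function of the first [m] letters. *)
Lemma urn_expect_mean m n h : (m <= n)%N ->
  urn_expect n (fun b => h (take m b) * urn_mean b) =
  urn_expect m (fun b => h b * urn_mean b).
Proof.
elim: n => [|n IH]; first by rewrite leqn0 => /eqP ->.
rewrite leq_eqVlt => /orP[/eqP ->|].
  by apply: eq_urn_expect => b <-; rewrite take_size.
rewrite ltnS => mn; rewrite -IH//=; apply: eq_urn_expect => b bn.
rewrite /urn_step !(takeE _ mn bn) !urn_mean_rcons /=.
have := pos (size b).+1; set t := _ + theta => t0; field; lra.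
Qed.

(* The conditional variance of the increment at time n is at most
   M_n/(n+1+theta)^2 <= M_n(1/(n+theta) - 1/(n+1+theta)); hence
   (M_n - M_m)^2 + M_n/(n+theta) is a supermartingale for n >= m. *)
Lemma urn_variance m n h : (m <= n)%N -> (forall b, 0 <= h b) ->
  urn_expect n (fun b => h (take m b) * (urn_mean b - urn_mean (take m b)) ^+ 2)
  <= urn_expect m (fun b => h b * urn_mean b) / (m%:R + theta).
Proof.
move=> mn h0.
suff H : urn_expect n (fun b => h (take m b) *
    ((urn_mean b - urn_mean (take m b)) ^+ 2 + urn_mean b / (n%:R + theta)))
    <= urn_expect m (fun b => h b * urn_mean b) / (m%:R + theta).
  apply: le_trans H; apply: le_urn_expect => b _.
  by rewrite ler_wpM2l// lerDl divr_ge0 ?urn_mean_ge0// ltW.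
elim: n mn => [|n IH]; last first.
  rewrite leq_eqVlt => /orP[/eqP <-|].
    rewrite mulrC -urn_expectZ; apply: le_urn_expect => b bm.
    by rewrite -bm take_size subrr expr0n/= add0r mulrA [leRHS]mulrC.
  rewrite ltnS => mn; apply: le_trans (IH mn) => /=.
  apply: le_urn_expect => b bn; rewrite /urn_step !(takeE _ mn bn).
  rewrite !urn_mean_rcons bn /=.
  have := h0 (take m b); have := urn_mean_ge0 b; have := urn_mean_le1 b.
  have := pos n; rewrite -!natr1; set t := n%:R + theta => t0.
  rewrite (_ : n%:R + 1 + theta = t + 1); last by rewrite /t; ring.
  set M := urn_mean b; set M0 := urn_mean _; set k := h _ => M1 M_ge0 k0.
  rewrite -subr_ge0.
  rewrite [leRHS](_ : _ = k * M * (t ^-1 - (t + 1)^-1 - (1 - M) / (t + 1) ^+ 2)).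
    apply: mulr_ge0; first exact: mulr_ge0.
    rewrite subr_ge0 (_ : t^-1 - _ = (t * (t + 1))^-1); last by field; lra.
    rewrite -[leRHS]div1r ler_pM ?subr_ge0 ?invr_ge0 ?sqr_ge0//; first by lra.
    by rewrite lef_pV2 ?posrE ?exprn_gt0 ?mulr_gt0; nra.
  field; lra.
rewrite leqn0 => /eqP ->; rewrite /= subrr expr0n/= add0r.
by rewrite mulrA.
Qed.

(** Union bound over the time of the first hit: after [j] misses the conditional probability of a
    hit is exactly a / (j + theta). *)
Lemma urn_expect_has n :
  urn_expect n (fun b => (has id b)%:R) <= \sum_(j < n) a / (j%:R + theta).
Proof.
elim: n => [|n IH] /=; first by rewrite big_ord0.
rewrite big_ord_recr/=; apply: le_trans (lerD IH (lexx _)).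
rewrite -[X in _ + X](urn_expect_cst n) -urn_expectD.
apply: le_urn_expect => b bn; rewrite /urn_step !has_rcons/=.
have [hb|/negbTE hb] := boolP (has id b).
  rewrite !mulr1 subrKC lerDl divr_ge0// ltW//.
rewrite mulr1 mulr0 addr0 add0r /urn_mean bn.
by rewrite (_ : count id b = 0%N) ?addr0//; apply/eqP; rewrite -leqn0 leqNgt -has_count hb.
Qed.

(* The first term comes from the words with no hit before m (first moments),
   the second one from AM-GM on the others, with a free weight l. *)
Lemma urn_mean_diff m n (l : R) : (m <= n)%N -> 0 < l ->
  urn_expect n (fun b => `|urn_mean b - urn_mean (take m b)|) <=
  2 * a / (m%:R + theta) +
  (l * (a / theta / (m%:R + theta)) +
   l^-1 * \sum_(j < m) a / (j%:R + theta)) / 2.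
Proof.
move=> mn l0.
pose no b : R := (~~ has id b)%:R; pose yes b : R := (has id b)%:R.
have Emean k : urn_expect k urn_mean = a / theta.
  have := @urn_expect_mean 0 k (fun=> 1) (leq0n _).
  rewrite /= mul1r {2}/urn_mean/= addr0 add0r => <-.
  by apply: eq_urn_expect => b _; rewrite mul1r.
apply: (@le_trans _ _ (urn_expect n (fun b =>
    (no (take m b) * urn_mean b + no (take m b) * urn_mean (take m b)) +
    (l / 2 * (yes (take m b) * (urn_mean b - urn_mean (take m b)) ^+ 2) +
     l^-1 / 2 * yes (take m b))))).
  apply: le_urn_expect => b _; rewrite /no /yes.
  have := urn_mean_ge0 b; have := urn_mean_ge0 (take m b).
  set M := urn_mean b; set M0 := urn_mean _ => M0_ge0 M_ge0.
  case: has => /=; rewrite ?mul0r ?mul1r ?mulr0 ?mulr1 ?addr0 ?add0r; last first.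
    by apply: le_trans (ler_normB _ _) _; rewrite !ger0_norm.
  rewrite -real_normK ?num_real//; set x := `|_|.
  rewrite -subr_ge0 (_ : _ - _ = l^-1 / 2 * (l * x - 1) ^+ 2); last by field; lra.
  by rewrite mulr_ge0 ?sqr_ge0// divr_ge0// invr_ge0 ltW.
(* The martingale property replaces the mean at time n by the one at time m, which on a word without
   hits equals a / (m + theta). *)
rewrite !urn_expectD !urn_expectZ (urn_expect_mean _ mn).
rewrite (urn_expect_take (fun b => no b * urn_mean b) mn).
rewrite (urn_expect_take yes mn).
have noE : urn_expect m (fun b => no b * urn_mean b) <= a / (m%:R + theta).
  rewrite -[leRHS](urn_expect_cst m); apply: le_urn_expect => b bm.
  rewrite /no; have [hb|hb] := boolP (has id b) => /=.
    by rewrite mul0r divr_ge0// ltW.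
  rewrite mul1r /urn_mean bm (_ : count id b = 0%N) ?addr0//.
  by apply/eqP; rewrite -leqn0 leqNgt -has_count.
have V : urn_expect n (fun b => yes (take m b) * (urn_mean b - urn_mean (take m b)) ^+ 2)
    <= a / theta / (m%:R + theta).
  apply: le_trans (urn_variance mn _) _; first by move=> b; rewrite /yes ler0n.
  rewrite ler_pM2r ?invr_gt0// -(Emean m); apply: le_urn_expect => b _.
  by rewrite /yes ler_piMl ?urn_mean_ge0 ?lern1 ?leq_b1.
have W := urn_expect_has m.
have l2 : 0 <= l^-1 / 2 by rewrite divr_ge0// invr_ge0 ltW.
rewrite [X in _ <= _ + X]mulrDl; apply: lerD; last apply: lerD.
- by rewrite -mulrA; lra.
- by rewrite [leRHS]mulrAC ler_wpM2l// divr_ge0// ltW.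
- by rewrite [leRHS]mulrAC ler_wpM2l.
Qed.

Let rising_shift k (u : R) :
  (\prod_(i < k) (u + 1 + i%:R)) * u = (\prod_(i < k) (u + i%:R)) * (u + k%:R).
Proof.
elim: k => [|k IH]; first by rewrite !big_ord0 addr0.
by rewrite !big_ord_recr/= mulrAC IH -natr1; ring.
Qed.

(** The product is the conditional probability that the next [k] letters are all [false]. As such it
    is a martingale, so its expectation is its value at the empty word. *)
Lemma urn_rising_factorial k n :
  urn_expect n (fun b => \prod_(i < k)
    (((size b)%:R + theta - (a + (count id b)%:R) + i%:R) /
     ((size b)%:R + theta + i%:R))) =
  \prod_(i < k) ((theta - a + i%:R) / (theta + i%:R)).
Proof.
elim: n => [|n IH] /=.
  by apply: eq_bigr => i _; rewrite /= add0r addr0.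
rewrite -[RHS]IH; apply: eq_urn_expect => b bn; rewrite /urn_step.
rewrite !size_rcons -!cats1 !count_cat/= !addn0 !natrD -!natr1 bn /urn_mean bn.
have := pos n; set t := n%:R + theta => t0.
set c := a + (count id b)%:R.
have -> : n%:R + 1 + theta = t + 1 by rewrite /t; ring.
rewrite add0r; have -> : a + ((count id b)%:R + 1) = c + 1 by rewrite /c addrA.
have -> : t + 1 - (c + 1) = t - c by ring.
have -> : t + 1 - c = (t - c) + 1 by ring.
rewrite !prodf_div.
have := rising_shift k t; have := rising_shift k (t - c).
have tk : 0 < t + k%:R by rewrite ltr_wpDr.
have : \prod_(i < k) (t + i%:R) != 0.
  by rewrite gt_eqF// prodr_gt0// => i _; rewrite ltr_wpDr.
have : \prod_(i < k) (t + 1 + i%:R) != 0.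
  by rewrite gt_eqF// prodr_gt0// => i _; rewrite ltr_wpDr// addr_gt0.
set T1 := \prod_(i < k) (t + 1 + i%:R); set T := \prod_(i < k) (t + i%:R).
set U := \prod_(i < k) (t - c + i%:R); set U1 := \prod_(i < k) (t - c + 1 + i%:R).
move=> T10 T0 HU HT.
have -> : T1 = T * (t + k%:R) / t by rewrite -HT; field; lra.
have -> : c / t * (U / (T * (t + k%:R) / t)) + (1 - c / t) * (U1 / (T * (t + k%:R) / t))
  = (c * U + U1 * (t - c)) / (T * (t + k%:R)) by field; lra.
by rewrite HU; field; lra.
Qed.

(** With t the total weight and c the weight of [true], each factor (t - c + i) / (t + i) of the
    rising factorial martingale is at least (t - c) / t. *)
Lemma urn_escape k n :
  urn_expect n (fun b => (1 - urn_mean b) ^+ k) <=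
  \prod_(i < k) ((theta - a + i%:R) / (theta + i%:R)).
Proof.
rewrite -(urn_rising_factorial k n); apply: le_urn_expect => b bn.
rewrite -[X in _ ^+ X](card_ord k) -prodr_const; apply: ler_prod => i _.
rewrite subr_ge0 urn_mean_le1/= /urn_mean.
have := pos (size b); set t := _ + theta => t0.
have := count_size id b; rewrite -(ler_nat R) => cn.
set c := a + _.
have ct : c <= t by rewrite /c /t addrC lerD.
have c0 : 0 <= c by rewrite /c addr_ge0.
have ti : 0 < t + i%:R by rewrite ltr_wpDr.
have x0 : 0 <= (i%:R : R) by [].
move: ti x0; set x : R := i%:R => ti x0.
rewrite ler_pdivlMr//.
have -> : (1 - c / t) * (t + x) = t - c + (1 - c / t) * x.
  by field; rewrite gt_eqF.
rewrite lerD2l ler_piMl// gerBl divr_ge0// ltW//.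
Qed.

Lemma rising_ratio_cvg0 (e : R) : 0 < a -> 0 < e ->
  exists k, \prod_(i < k) ((theta - a + i%:R) / (theta + i%:R)) < e.
Proof.
move=> a_gt0 e0.
have thi i : 0 < theta + i%:R by rewrite ltr_wpDr.
have P0 k : 0 <= \prod_(i < k) ((theta - a + i%:R) / (theta + i%:R)).
  apply: prodr_ge0 => i _; apply: divr_ge0; last exact: ltW (thi i).
  by rewrite addr_ge0// subr_ge0.
(* (1 - x) * (1 + x) <= 1, so the product is at most
   1 / prod (1 + x_i) <= 1 / (1 + sum x_i), with x_i = a / (theta + i) *)
have H k : (\prod_(i < k) ((theta - a + i%:R) / (theta + i%:R))) *
    (1 + \sum_(i < k) a / (theta + i%:R)) <= 1.
  elim: k => [|k IH]; first by rewrite !big_ord0 addr0 mulr1.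
  rewrite !big_ord_recr/= (_ : (theta - a + k%:R) / _ = 1 - a / (theta + k%:R)); last first.
    by field; rewrite gt_eqF.
  set P := \prod_(i < k) _ in IH *; set s := \sum_(i < k) _ in IH *.
  set x := a / (theta + k%:R).
  have x0 : 0 <= x by rewrite divr_ge0// ltW.
  have s0 : 0 <= s by apply: sumr_ge0 => i _; rewrite divr_ge0// ltW.
  apply: le_trans IH; rewrite -mulrA ler_wpM2l ?P0//; nra.
(* If these sums stayed bounded, the harmonic series would converge, because 1 / (i + 1) is at most
   (theta + 1) / (theta + i). *)
have [k hk] : exists k, e^-1 < \sum_(i < k) a / (theta + i%:R).
  apply: contrapT => /forallNP nk.
  have ub k : \sum_(i < k) a / (theta + i%:R) <= e^-1.
    by rewrite leNgt; apply/negP; exact: nk.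
  have cv : cvgn (series (@harmonic R)).
    apply: nondecreasing_is_cvgn.
      by apply: nondecreasing_series => n _ _; exact: harmonic_ge0.
    exists ((theta + 1) / a * e^-1) => _ [n _ <-].
    rewrite seriesEord/=.
    apply: (@le_trans _ _ ((theta + 1) / a * \sum_(i < n) a / (theta + i%:R))).
      rewrite mulr_sumr; apply: ler_sum => i _ /=.
      rewrite mulrA divfK ?gt_eqF// /harmonic/=.
      have ip : 0 < (i.+1%:R : R) by [].
      rewrite -[leLHS]div1r ler_pdivrMr// mulrAC ler_pdivlMr// mul1r -natr1.
      have i0 : 0 <= (i%:R : R) by [].
      rewrite (_ : _ * _ = theta + i%:R + (theta * i%:R + 1)); last by ring.
      by rewrite lerDl addr_ge0// mulr_ge0// ltW.
    by apply: ler_wpM2l; [rewrite divr_ge0// addr_ge0// ltW|exact: ub].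
  exact: (dvg_harmonic cv).
exists k; have := H k; have := P0 k.
set P := \prod_(i < k) _; set s := \sum_(i < k) _ in hk * => Pk0 PS.
have e1 : 0 < e^-1 by rewrite invr_gt0.
have [//|eP] := ltP P e.
have : e * (1 + s) <= 1 by apply: le_trans PS; rewrite ler_wpM2r//; lra.
have : 1 < e * s by rewrite -(mulfV (lt0r_neq0 e0)) ltr_pM2l.
nra.
Qed.

End two_colour_urn.

(** * Summable rates along the eighth powers *)

Lemma sum_inv_le_sqrt (R : realType) m :
  \sum_(j < m) (j.+1%:R : R)^-1 <= 2 * Num.sqrt m%:R.
Proof.
elim: m => [|m IH]; first by rewrite big_ord0 sqrtr0 mulr0.
rewrite big_ord_recr/=.
have r2 : Num.sqrt (m.+1%:R : R) ^+ 2 = m.+1%:R by rewrite sqr_sqrtr.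
have s2 : Num.sqrt (m%:R : R) ^+ 2 = m%:R by rewrite sqr_sqrtr.
have s0 : 0 <= Num.sqrt (m%:R : R) by rewrite sqrtr_ge0.
have r1 : 1 <= Num.sqrt (m.+1%:R : R) by rewrite -[leLHS]sqrtr1 ler_wsqrtr ?ler1n.
move: r2 s2 IH s0 r1; set r := Num.sqrt m.+1%:R; set s := Num.sqrt m%:R.
move=> r2 s2 IH s0 r1; rewrite -r2.
have H : r ^+ 2 = s ^+ 2 + 1 by rewrite r2 s2 natr1.
suff : (r ^+ 2)^-1 <= 2 * (r - s) by lra.
have sr : s <= r by nra.
rewrite -[leLHS]div1r ler_pdivrMr ?exprn_gt0//; last by lra.
have -> : 2 * (r - s) * r ^+ 2 = ((r - s) * (r + s)) + (r - s) * (2 * r ^+ 2 - r - s) by ring.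
have -> : (r - s) * (r + s) = 1 by lra.
rewrite lerDl mulr_ge0//; nra.
Qed.

(** At m = (k + 1)^8 the power m^(-1/4) is 1 / (k + 1)^2. The constant dominates 2 theta + (1 + 2 (1
    + theta)) / 2, which collects the three terms of [urn_mean_diff] once the logarithmic sum is
    bounded by a square root. *)
Definition urn_rate (R : realType) (theta : R) (k : nat) : R :=
  (2 + 3 * theta) / k.+1%:R ^+ 2.

(* At time m = (k+1)^8 the weight l = m^(3/4) makes both terms of
   [urn_mean_diff] of order m^(-1/4), which is summable in k. *)
Definition urn_weight (R : realType) (k : nat) : R := k.+1%:R ^+ 6.

Lemma urn_rateP (R : realType) (theta : R) k (m := (k.+1 ^ 8)%N)
    (l := urn_weight R k) : 0 < theta ->
  2 * theta / (m%:R + theta) +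
  (l * (1 / (m%:R + theta)) +
   l^-1 * \sum_(j < m) theta / (j%:R + theta)) / 2 <= urn_rate theta k.
Proof.
move=> t0; rewrite /urn_rate /l /urn_weight.
have mE : m%:R = k.+1%:R ^+ 8 :> R by rewrite /m natrX.
have k1 : 1 <= (k.+1%:R : R) by rewrite ler1n.
move: mE k1; set p := k.+1%:R => mE k1.
(* Termwise, theta / (j + theta) is at most (1 + theta) / (j + 1); the square root of m is (k +
   1)^4. *)
have S : \sum_(j < m) theta / (j%:R + theta) <= (1 + theta) * (2 * p ^+ 4).
  apply: (@le_trans _ _ ((1 + theta) * \sum_(j < m) (j.+1%:R : R)^-1)).
    rewrite mulr_sumr; apply: ler_sum => j _.
    have j0 : 0 <= (j%:R : R) by [].
    rewrite ler_pdivrMr; last by lra.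
    rewrite mulrAC ler_pdivlMr// -natr1; nra.
  rewrite ler_wpM2l//; first by lra.
  apply: le_trans (sum_inv_le_sqrt R m) _; rewrite ler_pM2l// mE.
  by rewrite (_ : p ^+ 8 = (p ^+ 4) ^+ 2) ?sqrtr_sqr ?ger0_norm// ?exprn_ge0 -?exprM//; lra.
have p2 : 1 <= p ^+ 2 by rewrite exprn_ege1.
have p6 : 1 <= p ^+ 6 by rewrite exprn_ege1.
have E8 : p ^+ 8 = p ^+ 2 * p ^+ 6 by rewrite -exprD.
have E6 : p ^+ 6 = p ^+ 2 * p ^+ 4 by rewrite -exprD.
have p0 : p ^+ 2 != 0 by rewrite gt_eqF//; lra.
have A : 2 * theta / (m%:R + theta) <= 2 * theta / p ^+ 2.
  rewrite ler_wpM2l//; first by lra.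
  rewrite lef_pV2 ?posrE ?mE; [|by rewrite ltr_wpDl ?exprn_ge0//; lra|by lra].
  by rewrite E8; nra.
have B : p ^+ 6 * (1 / (m%:R + theta)) <= 1 / p ^+ 2.
  rewrite mulrA mulr1 ler_pdivrMr ?mE; last by rewrite ltr_wpDl ?exprn_ge0//; lra.
  rewrite E8 mulrDr mulrA divfK// mul1r.
  by rewrite mul1r lerDl mulr_ge0 ?invr_ge0//; lra.
have C0 : (p ^+ 6)^-1 * \sum_(j < m) theta / (j%:R + theta) <= (1 + theta) * 2 / p ^+ 2.
  rewrite mulrC ler_pdivrMr; last by lra.
  apply: le_trans S _.
  by rewrite E6 [leRHS]mulrA divfK// !mulrA.
apply: le_trans (lerD A (ler_wpM2r _ (lerD B C0))) _ => //.
have q0 : 0 < (p ^+ 2)^-1 by rewrite invr_gt0; lra.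
by move: q0; set q := (p ^+ 2)^-1 => q0; nra.
Qed.

Lemma sum_urn_rate (R : realType) (theta : R) n : 0 < theta ->
  \sum_(k < n) urn_rate theta k <= 2 * (2 + 3 * theta).
Proof.
(* The induction carries the telescoping slack 1 - 1 / (n + 1), based on 1 / x^2 <= 2 (1 / x - 1 /
   (x + 1)) for x >= 1. *)
move=> t0; have H : \sum_(k < n) urn_rate theta k <= 2 * (2 + 3 * theta) * (1 - n.+1%:R^-1).
  elim: n => [|n IH]; first by rewrite big_ord0 invr1 subrr mulr0.
  rewrite big_ord_recr/=; apply: le_trans (lerD IH (lexx _)) _.
  rewrite /urn_rate; have n0 : 0 < (n.+1%:R : R) by [].
  rewrite -(natr1 n.+1); set x := n.+1%:R in n0 *.
  have x1 : 1 <= x by rewrite ler1n.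
  rewrite -subr_ge0 (_ : _ - _ = (2 + 3 * theta) * (x - 1) / (x ^+ 2 * (x + 1))); last by field; lra.
  by rewrite divr_ge0// ?mulr_ge0 ?sqr_ge0//; lra.
by apply: le_trans H _; rewrite ler_piMr//; lra.
Qed.

(** * Smoothed averages *)

Section weighted_average.
Context (R : realType) (theta : R) (theta0 : 0 < theta).
Implicit Types (v : R) (k : nat -> R).

(** Predictive probability of a set when [v] is its prior mass and [k i] its mass under K(X_i); urn
    mean of a colour when [k] is the sequence of its indicators. *)
Definition smoothed_mean v k n : R := (theta * v + \sum_(i < n) k i) / (n%:R + theta).

Let pos n : 0 < n%:R + theta :> R.
Proof. by rewrite ltr_wpDl. Qed.

Lemma smoothed_mean_itv v k n : 0 <= v <= 1 -> (forall i, 0 <= k i <= 1) ->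
  0 <= smoothed_mean v k n <= 1.
Proof.
move=> /andP[v0 v1] k01.
have S0 : 0 <= \sum_(i < n) k i by apply: sumr_ge0 => i _; case/andP: (k01 i).
have S1 : \sum_(i < n) k i <= n%:R.
  rewrite -[X in _ <= X%:R](card_ord n) -sumr_const; apply: ler_sum => i _.
  by case/andP: (k01 i).
rewrite /smoothed_mean divr_ge0 ?addr_ge0 ?mulr_ge0//=; try exact: ltW.
rewrite ler_pdivrMr// mul1r addrC lerD//.
by rewrite ler_piMr// ltW.
Qed.

(** Deterministic bound on the effect of n - m further terms in [0, 1]; it controls the times lying
    inside a block. *)
Lemma smoothed_mean_close v k m n : 0 <= v <= 1 -> (forall i, 0 <= k i <= 1) ->
  (m <= n)%N ->
  `|smoothed_mean v k n - smoothed_mean v k m| <= (n - m)%:R / (n%:R + theta).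
Proof.
move=> v01 k01 mn; have /andP[q0 q1] := @smoothed_mean_itv v k m v01 k01.
pose T := \sum_(m <= i < n) k i.
have T0 : 0 <= T by apply: sumr_ge0 => i _; case/andP: (k01 i).
have T1 : T <= (n - m)%:R.
  have -> : (n - m)%:R = \sum_(m <= i < n) (1 : R) by rewrite sumr_const_nat.
  apply: ler_sum => i _.
  by case/andP: (k01 i).
have E : smoothed_mean v k n - smoothed_mean v k m =
    (T - (n - m)%:R * smoothed_mean v k m) / (n%:R + theta).
  have -> : smoothed_mean v k n = (smoothed_mean v k m * (m%:R + theta) + T) / (n%:R + theta).
    rewrite {2}/smoothed_mean divfK ?gt_eqF// /smoothed_mean; congr (_ / _).
    by rewrite -addrA; congr (_ + _); rewrite -!(big_mkord predT k) /T -big_cat_nat.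
  rewrite natrB//; have := pos n; set q := smoothed_mean v k m => pn; field.
  by rewrite gt_eqF.
rewrite E normrM normfV (gtr0_norm (pos n)) ler_pM2r ?invr_gt0//.
have nm0 : 0 <= (n - m)%:R :> R by [].
rewrite ler_norml; apply/andP; split; nra.
Qed.

Lemma smoothed_mean_le (v v' e : R) (k k' : nat -> R) n :
  `|v - v'| <= e -> (forall i, (i < n)%N -> `|k i - k' i| <= e) ->
  `|smoothed_mean v k n - smoothed_mean v' k' n| <= e.
Proof.
move=> vv' kk'; rewrite /smoothed_mean -mulrBl normrM normfV (gtr0_norm (pos n)).
rewrite ler_pdivrMr//.
rewrite (_ : _ - _ = theta * (v - v') + (\sum_(i < n) k i - \sum_(i < n) k' i));
  last by ring.
rewrite -sumrB; apply: le_trans (ler_normD _ _) _.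
rewrite [leRHS]mulrDr [leLHS]addrC; apply: lerD.
  apply: le_trans (ler_norm_sum _ _ _) _.
  rewrite -[X in _ * X%:R](card_ord n) mulr_natr -sumr_const; apply: ler_sum => i _.
  exact: kk'.
by rewrite normrM (gtr0_norm theta0) mulrC ler_pM2r.
Qed.

Lemma cvg_theta_div : theta / (n%:R + theta) @[n --> \oo] --> (0 : R).
Proof.
apply/cvgrPdist_le => e e0.
have et0 : 0 < e / theta by rewrite divr_gt0.
have [N _ HN] := near_infty_natSinv_lt (PosNum et0).
exists N.+1 => // -[//|n] /= Nn; have /= := HN n Nn.
rewrite sub0r normrN => H; rewrite ger0_norm; last by rewrite divr_ge0 ?ltW.
apply: (@le_trans _ _ (theta * n.+1%:R^-1)).
  by rewrite ler_pM2l// lef_pV2 ?posrE// lerDl ltW.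
by rewrite mulrC -ler_pdivlMr// ltW.
Qed.

(* If the observations take a common value on each class, the difference is
   sum_s kappa s * (difference of the class frequencies), up to the
   contribution of the prior weights. *)
Lemma smoothed_mean_classes (I : finType) (c : nat -> I) v k (u : I -> R) m n :
  0 <= v <= 1 -> (forall i, 0 <= k i <= 1) ->
  (forall s, 0 <= u s) -> \sum_s u s = 1 ->
  (forall i j, (i < n)%N -> (j < n)%N -> c i = c j -> k i = k j) ->
  (m <= n)%N ->
  `|smoothed_mean v k n - smoothed_mean v k m| <= theta / (m%:R + theta) +
    \sum_s `|smoothed_mean (u s) (fun i => (c i == s)%:R) n -
             smoothed_mean (u s) (fun i => (c i == s)%:R) m|.
Proof.
move=> /andP[v0 v1] k01 u0 u1 ck mn.
(* [kap s] is the common value on the class [s], with default 0 for a class not met before time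
   n. *)
have [kap kapE] : exists kap : I -> R, (forall s, 0 <= kap s <= 1) /\
    forall i, (i < n)%N -> k i = kap (c i).
  exists (fun s => if [pick i : 'I_n | c i == s] is Some i then k i else 0).
  split=> [s|i ni]; first by case: pickP => // _; rewrite lexx ler01.
  case: pickP => [j /eqP cj|/(_ (Ordinal ni))]; last by rewrite eqxx.
  exact: ck.
have [kap01 kE] := kapE.
have sumE l : (l <= n)%N ->
    \sum_(i < l) k i = \sum_s kap s * \sum_(i < l) (c i == s)%:R.
  move=> ln; under [RHS]eq_bigr do rewrite mulr_sumr.
  rewrite exchange_big/=; apply: eq_bigr => i _.
  rewrite (bigD1 (c i))//= eqxx mulr1 big1 ?addr0; last first.
    by move=> s /negbTE; rewrite eq_sym => ->; rewrite mulr0.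
  by apply: kE; exact: leq_trans ln.
(* [w] is the prior mass that the class values would produce. The discrepancy v - w, weighted by
   theta / (m + theta), accounts for the extra term of the bound. *)
pose w := \sum_s kap s * u s.
have w0 : 0 <= w by apply: sumr_ge0 => s _; rewrite mulr_ge0//; case/andP: (kap01 s).
have w1 : w <= 1.
  rewrite -u1; apply: ler_sum => s _; rewrite ler_piMl//.
  by case/andP: (kap01 s).
have qE l : (l <= n)%N -> smoothed_mean v k l = theta * (v - w) / (l%:R + theta) +
    \sum_s kap s * smoothed_mean (u s) (fun i => (c i == s)%:R) l.
  move=> ln; rewrite /smoothed_mean sumE//.
  under [X in _ = _ + X]eq_bigr do rewrite mulrA.
  rewrite -mulr_suml -mulrDl; congr (_ / _).
  under [X in _ = _ + X]eq_bigr do rewrite mulrDr mulrCA.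
  rewrite big_split/= -mulr_sumr -/w; ring.
rewrite !qE// (_ : _ - _ =
  theta * (v - w) * ((n%:R + theta)^-1 - (m%:R + theta)^-1) +
  \sum_s kap s * (smoothed_mean (u s) (fun i => (c i == s)%:R) n -
             smoothed_mean (u s) (fun i => (c i == s)%:R) m)); last first.
  under [X in _ = _ + X]eq_bigr do rewrite mulrBr.
  rewrite sumrB; ring.
apply: le_trans (ler_normD _ _) _; apply: lerD.
  have nm : (n%:R + theta)^-1 <= (m%:R + theta)^-1 by rewrite lef_pV2 ?posrE// lerD2r ler_nat.
  have n0 : 0 < (n%:R + theta)^-1 by rewrite invr_gt0.
  rewrite -mulrA normrM (gtr0_norm theta0) ler_pM2l// normrM.
  rewrite -[leRHS]mul1r; apply: ler_pM => //.
    by rewrite ler_norml; apply/andP; split; lra.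
  by rewrite ler_norml; apply/andP; split; lra.
apply: le_trans (ler_norm_sum _ _ _) _; apply: ler_sum => s _.
have /andP[k0 k1] := kap01 s.
by rewrite normrM ger0_norm// ler_piMl.
Qed.

Let N l := (l.+1 ^ 8)%N.

Let bracket n : (1 <= n)%N -> forall j, (N j <= n)%N ->
  exists l, [/\ (j <= l)%N, (N l <= n)%N & (n < N l.+1)%N].
Proof.
move=> n1 j kn; have ex : exists i, (N i <= n)%N by exists j.
have ub i : (N i <= n)%N -> (i <= n)%N.
  apply: leq_trans; apply: ltnW; apply: leq_trans (ltnSn i) _.
  by rewrite -[X in (X <= _)%N]expn1 leq_pexp2l.
case: (ex_maxnP ex ub) => l Nl lmax; exists l; split=> //; first exact: lmax.
by rewrite ltnNge; apply/negP => /lmax; rewrite ltnn.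
Qed.

(** Bernoulli-type bound: (p + 1)^j <= p^(j - 1) (p + 2^j - 1) for p >= 1, by repeated squaring for
    j = 2, 4, 8; hence the constants 3, 15 and 255. *)
Let gap l : (N l.+1 - N l)%:R <= 255 / l.+1%:R * (N l)%:R :> R.
Proof.
rewrite natrB ?leq_exp2r// /N !natrX -(natr1 l.+1).
have p1 : 1 <= l.+1%:R :> R by rewrite ler1n.
move: p1; set p := l.+1%:R => p1.
have -> : 255 / p * p ^+ 8 = 255 * p ^+ 7 by field; lra.
have e2 : (p + 1) ^+ 2 <= p * (p + 3) by nra.
have e4 : (p + 1) ^+ 4 <= p ^+ 3 * (p + 15).
  rewrite (_ : (p + 1) ^+ 4 = ((p + 1) ^+ 2) ^+ 2); last by ring.
  apply: (@le_trans _ _ ((p * (p + 3)) ^+ 2)).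
    by rewrite lerXn2r ?nnegrE ?sqr_ge0//; nra.
  rewrite (_ : _ ^+ 2 = p ^+ 2 * (p + 3) ^+ 2); last by ring.
  rewrite (_ : p ^+ 3 * _ = p ^+ 2 * (p * (p + 15))); last by ring.
  by rewrite ler_wpM2l ?sqr_ge0//; nra.
have e8 : (p + 1) ^+ 8 <= p ^+ 7 * (p + 255).
  rewrite (_ : (p + 1) ^+ 8 = ((p + 1) ^+ 4) ^+ 2); last by ring.
  apply: (@le_trans _ _ ((p ^+ 3 * (p + 15)) ^+ 2)).
    by rewrite lerXn2r ?nnegrE ?mulr_ge0 ?exprn_ge0//; lra.
  rewrite (_ : _ ^+ 2 = p ^+ 6 * (p + 15) ^+ 2); last by ring.
  rewrite (_ : p ^+ 7 * _ = p ^+ 6 * (p * (p + 255))); last by ring.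
  by rewrite ler_wpM2l ?exprn_ge0//; nra.
rewrite (_ : p ^+ 8 = p ^+ 7 * p); last by ring.
by rewrite mulrDr in e8; lra.
Qed.

(** [M] is chosen before [j], so the convergence is uniform over [J], which will be the family of
    all measurable sets. Half of [e] pays for the steps between block times, the other half for the
    way from the last block time to n. *)
Lemma smoothed_mean_uniform_cauchy (J : Type) (v : J -> R) (k : J -> nat -> R)
    (rho : nat -> R) (B : R) :
  (forall j, 0 <= v j <= 1) -> (forall j i, 0 <= k j i <= 1) ->
  (forall l, 0 <= rho l) -> (forall n, \sum_(l < n) rho l <= B) ->
  (forall j l, `|smoothed_mean (v j) (k j) (l.+2 ^ 8) -
                 smoothed_mean (v j) (k j) (l.+1 ^ 8)| <= rho l) ->
  forall e : R, 0 < e -> exists M, forall n, (M <= n)%N -> forall j,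
    `|smoothed_mean (v j) (k j) n - smoothed_mean (v j) (k j) M| <= e.
Proof.
move=> v01 k01 rho0 rhoB step e e0.
have cv : cvgn (series rho).
  apply: nondecreasing_is_cvgn; first by apply: nondecreasing_series => n _ _; exact: rho0.
  by exists B => _ [n _ <-]; rewrite seriesEord/=; exact: rhoB.
have e2 : 0 < e / 2 by rewrite divr_gt0.
(* This threshold compensates the constant 255 of [gap]. *)
have e255 : 0 < e / 2 / 255 by rewrite divr_gt0.
have /cauchy_seriesP/(_ _ e2) : cauchy (series rho @ \oo) by exact: cvg_cauchy.
move=> [[U1 U2]/= [[a _ Ha] [b _ Hb]] HU].
have [c _ /(_ _ (leqnn c))] := near_infty_natSinv_lt (PosNum e255).
move=> /= Hc.
pose k0 := maxn (maxn a b) c.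
have tail l : (k0 <= l)%N -> \sum_(k0 <= i < l) rho i <= e / 2.
  move=> kl; have /ltW : `|\sum_(k0 <= i < l) rho i| < e / 2.
    apply: (HU (k0, l)); split => /=.
      by apply: Ha => /=; rewrite /k0 -maxnA leq_maxl.
    by apply: Hb => /=; apply: leq_trans kl; rewrite /k0 -maxnA maxnCA leq_maxl.
  by rewrite ger0_norm// sumr_ge0.
exists (N k0) => n Nn j.
have n1 : (1 <= n)%N by apply: leq_trans Nn; rewrite /N expn_gt0.
have [l [kl Nl nN]] := bracket n1 Nn.
set q := smoothed_mean (v j) (k j).
have A1 : `|q (N l) - q (N k0)| <= e / 2.
  apply: le_trans (tail _ kl).
  elim: l kl {Nl nN} => [|l IH]; first by rewrite leqn0 => /eqP ->; rewrite subrr normr0 sumr_ge0.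
  rewrite leq_eqVlt => /orP[/eqP <-|]; first by rewrite subrr normr0 sumr_ge0.
  rewrite ltnS => kl; rewrite big_nat_recr//=.
  rewrite (_ : _ - _ = (q (N l) - q (N k0)) + (q (N l.+1) - q (N l))); last by ring.
  apply: le_trans (ler_normD _ _) _; apply: lerD; [exact: IH|exact: step].
have A2 : `|q n - q (N l)| <= e / 2.
  apply: le_trans (smoothed_mean_close (v01 j) (k01 j) Nl) _.
  rewrite ler_pdivrMr//.
  have lc : l.+1%:R^-1 <= e / 2 / 255.
    apply: le_trans (ltW Hc); rewrite lef_pV2 ?posrE// ler_nat ltnS.
    by apply: leq_trans kl; rewrite /k0 leq_maxr.
  apply: (@le_trans _ _ (N l.+1 - N l)%:R).
    by rewrite ler_nat leq_sub2r// ltnW.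
  apply: le_trans (gap l) _; apply: ler_pM => //.
  - by move: lc; set x := _^-1; lra.
  - have : (N l)%:R <= n%:R :> R by rewrite ler_nat.
    by move: theta0; lra.
rewrite (_ : q n - _ = (q n - q (N l)) + (q (N l) - q (N k0))); last by ring.
by apply: le_trans (ler_normD _ _) _; lra.
Qed.

End weighted_average.

(** * Countably generated spaces *)

Section bits.
Context (T : Type) (A : nat -> set T).

Definition bits N (x : T) : seq bool := mkseq (fun i => `[< A i x >]) N.

(** A code, made of a level and a list of accepted patterns, for a member of the algebra generated
    by [A]. Codes form a countable type, so a quantifier over the algebra becomes a countable
    operation. *)
Definition cell_union (t : nat * seq (seq bool)) : set T :=
  [set x | bits t.1 x \in t.2].

Lemma size_bits N x : size (bits N x) = N.
Proof. exact: size_mkseq. Qed.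

Lemma bitsS N x : bits N.+1 x = rcons (bits N x) `[< A N x >].
Proof. exact: mkseqS. Qed.

Lemma take_bits M N x : (M <= N)%N -> take M (bits N x) = bits M x.
Proof.
elim: N => [|N IH]; first by rewrite leqn0 => /eqP ->.
rewrite leq_eqVlt => /orP[/eqP ->|].
  by rewrite -{1}(size_bits N.+1 x) take_size.
by rewrite ltnS => MN; rewrite bitsS -cats1 takel_cat ?size_bits// IH.
Qed.

Lemma nth_bits N i x : (i < N)%N -> nth false (bits N x) i = `[< A i x >].
Proof. exact: nth_mkseq. Qed.

Lemma bits_cell_union N (F : pred (seq bool)) :
  exists t, t.1 = N /\ cell_union t = [set x | F (bits N x)].
Proof.
exists (N, [seq tval s | s <- enum {: N.-tuple bool} & F (tval s)]); split=> //.
apply/seteqP; split => x; rewrite /cell_union/=.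
  by move=> /mapP[s]; rewrite mem_filter => /andP[Fs _] ->.
move=> Fx; apply/mapP; exists (Tuple (introT eqP (size_bits N x))) => //.
by rewrite mem_filter Fx mem_enum.
Qed.

Lemma cell_unionI t1 t2 : exists t, cell_union t = cell_union t1 `&` cell_union t2.
Proof.
have [t [_ tE]] := bits_cell_union (maxn t1.1 t2.1)
  (fun s => (take t1.1 s \in t1.2) && (take t2.1 s \in t2.2)).
exists t; rewrite tE; apply/seteqP; split => x;
  rewrite /cell_union/= !take_bits ?leq_maxl ?leq_maxr//.
  by move=> /andP.
by move=> [-> ->].
Qed.

Lemma cell_unionC t1 : exists t, cell_union t = ~` cell_union t1.
Proof.
have [t [_ tE]] := bits_cell_union t1.1 (fun s => s \notin t1.2).
by exists t; rewrite tE; apply/seteqP; split => x /negP.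
Qed.

Lemma cell_unionU t1 t2 : exists t, cell_union t = cell_union t1 `|` cell_union t2.
Proof.
have [s1 H1] := cell_unionC t1; have [s2 H2] := cell_unionC t2.
have [s H] := cell_unionI s1 s2; have [t Ht] := cell_unionC s.
by exists t; rewrite Ht H H1 H2 setCI !setCK.
Qed.

Lemma cell_union_generator i : exists t, cell_union t = A i.
Proof.
have [t [_ tE]] := bits_cell_union i.+1 (fun s => nth false s i).
exists t; rewrite tE; apply/seteqP; split => x; rewrite /= nth_bits//.
  by move/asboolP.
by move=> ?; apply/asboolP.
Qed.

Lemma cell_union0 : exists t, cell_union t = set0.
Proof. by exists (0%N, [::]); apply/seteqP; split => x. Qed.

(** Each pair of points told apart by some set is told apart at a finite level; finitely many pairs
    have a maximal such level. *)
Lemma bits_separate (I : finType) (f : I -> T) :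
  exists N0, forall N, (N0 <= N)%N -> forall i j,
    bits N (f i) = bits N (f j) -> forall k, A k (f i) <-> A k (f j).
Proof.
have /choice[g Hg] (p : I * I) : exists N0, forall N, (N0 <= N)%N ->
    bits N (f p.1) = bits N (f p.2) -> forall k, A k (f p.1) <-> A k (f p.2).
  have [H|] := pselect (forall k, A k (f p.1) <-> A k (f p.2)); first by exists 0%N.
  move=> /existsNP[k kN]; exists k.+1 => N kN' E; exfalso; apply: kN.
  have : nth false (bits N (f p.1)) k = nth false (bits N (f p.2)) k by rewrite E.
  rewrite !nth_bits// => Ek; split=> /asboolP.
    by rewrite Ek => /asboolP.
  by rewrite -Ek => /asboolP.
exists (\max_p g p) => N H i j; apply: (Hg (i, j)).
by apply: leq_trans H; exact: (leq_bigmax (i, j)).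
Qed.

End bits.
Arguments bits {T} A N x : simpl never.

(** Measurability is asked of the first [N] sets only, so that the lemma also applies in the
    sigma-field of the first n observations. *)
Lemma measurable_bits d (S : measurableType d) (A : nat -> set S) N (F : pred (seq bool)) :
  (forall i, (i < N)%N -> measurable (A i)) -> measurable [set x | F (bits A N x)].
Proof.
elim: N F => [|N IH] F mA.
  have [F0|F0] := boolP (F [::]).
    by rewrite (_ : [set _ | _] = setT)//; apply/seteqP; split.
  by rewrite (_ : [set _ | _] = set0)//; apply/seteqP; split=> // x /=; rewrite (negbTE F0).
have {}IH (F' : pred (seq bool)) : measurable [set x | F' (bits A N x)].
  by apply: (IH F') => i iN; apply: mA; exact: leqW.
rewrite (_ : [set _ | _] =
  (A N `&` [set x | F (rcons (bits A N x) true)]) `|`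
  (~` A N `&` [set x | F (rcons (bits A N x) false)])).
  apply: measurableU; apply: measurableI.
  - exact: mA.
  - exact: (IH (fun s => F (rcons s true))).
  - by apply: measurableC; exact: mA.
  - exact: (IH (fun s => F (rcons s false))).
apply/seteqP; split => x /=; rewrite bitsS.
  by have [Ax|Ax] := pselect (A N x); [rewrite asboolT//; left|rewrite asboolF//; right].
by case=> -[Ax]; [rewrite asboolT|rewrite asboolF].
Qed.

Lemma measurable_cell_union d (S : measurableType d) (A : nat -> set S) t :
  (forall i, measurable (A i)) -> measurable (cell_union A t).
Proof. by move=> mA; apply: (@measurable_bits _ _ _ _ (fun s => s \in t.2)). Qed.

Definition countably_generated d (S : measurableType d) (A : nat -> set S) :=
  @measurable _ S = <<s range A >>.

Definition separating (T : Type) (A : nat -> set T) :=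
  forall x y, (forall i, A i x <-> A i y) -> x = y.

Section generated.
Context (R : realType) (d : measure_display) (S : measurableType d).
Context (A : nat -> set S) (genA : countably_generated A).
Local Open Scope ereal_scope.

Lemma generator_measurable i : measurable (A i).
Proof. by rewrite genA; apply: sub_sigma_algebra; exists i. Qed.

Lemma cell_union_generates : @measurable _ S = <<s range (cell_union A) >>.
Proof.
rewrite genA; apply/seteqP; split.
  apply: smallest_sub; first exact: smallest_sigma_algebra.
  move=> _ [i _ <-].
  apply: sub_sigma_algebra; have [t <-] := cell_union_generator A i; by exists t.
apply: smallest_sub; first exact: smallest_sigma_algebra.
by move=> _ [t _ <-]; rewrite -genA; apply: measurable_cell_union; exact: generator_measurable.
Qed.

Lemma cell_union_setI : setI_closed (range (cell_union A)).
Proof. by move=> _ _ [t1 _ <-] [t2 _ <-]; have [t <-] := cell_unionI A t1 t2; exists t. Qed.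

(** The approximable sets form a Dynkin system: complements preserve symmetric differences, and a
    disjoint union is first truncated, then approximated piece by piece. Any finite measure is
    allowed, so that one code can serve several measures through their sum. *)
Lemma cell_union_approx (m : {measure set S -> \bar R}) :
  m setT < +oo -> forall B, measurable B -> forall e : R, (0 < e)%R ->
  exists t, m (B `+` cell_union A t) < e%:E.
Proof.
move=> moo B mB.
have mcu t : measurable (cell_union A t).
  by apply: measurable_cell_union; exact: generator_measurable.
have mY (C D : set S) : measurable C -> measurable D -> measurable (C `+` D).
  by move=> mC mD; apply: measurableU; exact: measurableD.
rewrite cell_union_generates in mB.
apply: (dynkin_induction (P := fun B => forall e : R, (0 < e)%R ->
  exists t, m (B `+` cell_union A t) < e%:E) cell_union_generates cell_union_setI) mB.
- move=> e e0; have [t0 H0] := cell_union0 A; have [t Ht] := cell_unionC A t0.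
  by exists t; rewrite Ht H0 setC0 setYK measure0.
- move=> _ [t _ <-] e e0; exists t; by rewrite setYK measure0.
- move=> C _ HC e e0; have [t Ht] := HC e e0; have [t' Ht'] := cell_unionC A t.
  exists t'; rewrite Ht' (_ : _ `+` _ = C `+` cell_union A t)//.
  by rewrite /setY !setDE !setCK setUC setIC [X in _ `|` X]setIC.
- move=> F mF tF HF e e0.
  have HU n e' : (0 < e')%R -> exists t, m (\big[setU/set0]_(i < n) F i `+` cell_union A t) < e'%:E.
    elim: n e' => [|n IH] e' e'0.
      by have [t tE] := cell_union0 A; exists t; rewrite tE big_ord0 setYK measure0.
    have e2 : (0 < e' / 2)%R by rewrite divr_gt0.
    have [t1 H1] := IH _ e2; have [t2 H2] := HF n _ e2.
    have [t Ht] := cell_unionU A t1 t2; exists t; rewrite Ht big_ord_recr/=.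
    have mU : measurable (\big[setU/set0]_(i < n) F i) by exact: bigsetU_measurable.
    apply: (@le_lt_trans _ _ (m ((\big[setU/set0]_(i < n) F i `+` cell_union A t1) `|`
      (F n `+` cell_union A t2)))).
      apply: le_measure; rewrite ?inE; [|apply: measurableU; exact: mY|].
        by apply: mY; exact: measurableU.
      move=> x; rewrite /setY/=; tauto.
    apply: le_lt_trans (measureU2 _ _ _) _; try exact: mY.
    by rewrite (splitr e') EFinD lteD.
  have e2 : (0 < e / 2)%R by rewrite divr_gt0.
  (* The tails of a disjoint sequence decrease to the empty set, so their measure tends to zero. *)
  pose G n := \bigcup_i F (n + i)%N.
  have mG n : measurable (G n) by exact: bigcupT_measurable.
  have : m \o G @ \oo --> m (\bigcap_n G n).
    apply: nonincreasing_cvg_mu => //.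
    - by apply: le_lt_trans moo; apply: le_measure; rewrite ?inE.
    - exact: bigcapT_measurable.
    - move=> i j ij; apply/subsetPset => x [k _ Fk].
      by exists (j - i + k)%N => //; rewrite addnA subnKC.
  rewrite (_ : \bigcap_n G n = set0); last first.
    apply/seteqP; split => // x Gx.
    have [i _ Fi] := Gx 0%N I; have [j _ Fj] := Gx i.+1 I.
    have := tF _ _ I I (ex_intro _ x (conj Fi Fj)).
    by move=> /eqP; rewrite add0n addSn eqn_leq => /andP[_]; rewrite ltnNge leq_addr.
  rewrite measure0 => /fine_cvgP[_].
  have mfin D : measurable D -> m D \is a fin_num.
    move=> mD; rewrite ge0_fin_numE//; apply: le_lt_trans moo.
    by apply: le_measure; rewrite ?inE.
  move=> /cvgrPdist_lt/(_ _ e2)[n _ /(_ n (leqnn _))]/=.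
  rewrite sub0r normrN ger0_norm ?fine_ge0// => Gn.
  have [t Ht] := HU n _ e2; exists t.
  have mU : measurable (\big[setU/set0]_(i < n) F i) by exact: bigsetU_measurable.
  apply: (@le_lt_trans _ _ (m ((\big[setU/set0]_(i < n) F i `+` cell_union A t) `|` G n))).
    apply: le_measure; rewrite ?inE; [|apply: measurableU => //; exact: mY|].
      by apply: mY => //; exact: bigcupT_measurable.
    by rewrite (bigcup_splitn n) => x; rewrite /setY/= -/(G n); tauto.
  apply: le_lt_trans (measureU2 _ _ _) _ => //; first exact: mY.
  have mGn : m (G n) < (e / 2)%:E by rewrite -[m _](fineK (mfin _ (mG n))) lte_fin.
  by rewrite (splitr e) EFinD lteD.
Qed.

End generated.

(** * Mass carried by a sigma-ideal *)

Section ideal_mass.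
Context (R : realType) (d : measure_display) (S : measurableType d).
Implicit Types (NN : set (set S)) (p : probability S R).
Local Open Scope ereal_scope.

Definition sigma_ideal NN := [/\ NN set0, NN `<=` measurable &
  forall F : nat -> set S, (forall n, NN (F n)) -> NN (\bigcup_n F n)].

Definition ideal_mass NN (p : set S -> \bar R) := ereal_sup [set p N | N in NN].

Variables (NN : set (set S)) (idN : sigma_ideal NN).

Lemma ideal_mass_ub p N : NN N -> p N <= ideal_mass NN p.
Proof. by move=> NNN; apply: ereal_sup_ubound; exists N. Qed.

Lemma ideal_mass_ge0 p : 0 <= ideal_mass NN p.
Proof. by rewrite -(measure0 p); apply: ideal_mass_ub; case: idN. Qed.

Lemma ideal_mass_le1 p : ideal_mass NN p <= 1.
Proof.
by apply: ge_ereal_sup => _ [N NNN <-]; apply: probability_le1; case: idN => _ + _; exact.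
Qed.

Lemma ideal_mass_fin p : ideal_mass NN p \is a fin_num.
Proof.
by rewrite ge0_fin_numE ?ideal_mass_ge0// (le_lt_trans (ideal_mass_le1 p)) ?ltry.
Qed.

Lemma ideal_mass_attained p : exists2 N, NN N & p N = ideal_mass NN p.
Proof.
have /choice[F HF] n : exists N, NN N /\ ideal_mass NN p - n.+1%:R^-1%:E < p N.
  have [_ [N NNN <-] H] := @ub_ereal_sup_adherent _ [set p N | N in NN] n.+1%:R^-1
    ltac:(by []) (ideal_mass_fin p).
  by exists N.
have [_ mN Nbig] := idN.
have NF : NN (\bigcup_n F n) by apply: Nbig => n; case: (HF n).
exists (\bigcup_n F n) => //; apply/eqP; rewrite eq_le ideal_mass_ub//=.
apply/lee_addgt0Pr => e e0.
have [n _ /(_ n (leqnn _)) ne] := near_infty_natSinv_lt (PosNum e0).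
have [NFn H] := HF n.
rewrite -leeBlDr//; apply: (@le_trans _ _ (ideal_mass NN p - n.+1%:R^-1%:E)).
  by rewrite leeB// lee_fin ltW.
apply: (le_trans (ltW H)); apply: le_measure; rewrite ?inE; [exact: (mN _ NFn)|exact: (mN _ NF)|].
exact: bigcup_sup.
Qed.

(** The union of the individual maximisers stays in the ideal and is maximal for every [p i]. On
    these measures the supremum thus becomes evaluation at a single set, which commutes with
    averages and limits. *)
Lemma ideal_mass_common (p : nat -> probability S R) :
  exists2 N, NN N & forall i, p i N = ideal_mass NN (p i).
Proof.
have /choice[F HF] n : exists N, NN N /\ p n N = ideal_mass NN (p n).
  by have [N ? ?] := ideal_mass_attained (p n); exists N.
have [_ mN Nbig] := idN.
have NF : NN (\bigcup_n F n) by apply: Nbig => n; case: (HF n).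
exists (\bigcup_n F n) => // i; apply/eqP; rewrite eq_le ideal_mass_ub//=.
have [Fi <-] := HF i; apply: le_measure; rewrite ?inE; [exact: (mN _ Fi)|exact: (mN _ NF)|].
exact: bigcup_sup.
Qed.

End ideal_mass.

(** * The ideals of null sets and of countable sets *)

Section null_ideal.
Context (R : realType) (d : measure_display) (S : measurableType d).
Variable nu : probability S R.
Local Open Scope ereal_scope.

Definition null_ideal : set (set S) := [set N | measurable N /\ nu N = 0].

Lemma sigma_ideal_null : sigma_ideal null_ideal.
Proof.
split; first by split.
  by move=> N [].
move=> F HF; split; first by apply: bigcupT_measurable => n; case: (HF n).
apply/eqP; rewrite eq_le measure_ge0 andbT.
apply: (@le_trans _ _ (\sum_(n <oo) nu (F n))).
  apply: measure_sigma_subadditive => //.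
  - by move=> n; case: (HF n).
  - by apply: bigcupT_measurable => n; case: (HF n).
by rewrite eseries0// => n _ _; case: (HF n).
Qed.

Lemma abs_cont_probE (p : pprobability S R) :
  abs_cont_prob nu p <-> ideal_mass null_ideal (p : probability S R) = 0.
Proof.
split.
  move=> /null_content_dominatesP pnu; apply/eqP; rewrite eq_le ideal_mass_ge0 ?andbT//;
    last exact: sigma_ideal_null.
  by apply: ge_ereal_sup => _ [N [mN N0] <-]; rewrite pnu.
move=> p0; apply/null_content_dominatesP => N mN N0.
by apply/eqP; rewrite eq_le measure_ge0 andbT -p0 ideal_mass_ub.
Qed.

End null_ideal.

Section countable_ideal.
Context (R : realType) (d : measure_display) (S : measurableType d).
Local Open Scope ereal_scope.

Definition countable_ideal : set (set S) := [set N | countable N /\ measurable N].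

Lemma sigma_ideal_countable : sigma_ideal countable_ideal.
Proof.
split; first by split.
  by move=> N [].
move=> F HF; split; first by apply: bigcup_countable => // n _; case: (HF n).
by apply: bigcupT_measurable => n; case: (HF n).
Qed.

Hypothesis m1 : forall x : S, measurable [set x].

Definition point_masses (p : set S -> \bar R) := [set x | 0 < p [set x]].

Lemma countable_point_masses (p : probability S R) : countable (point_masses p).
Proof.
rewrite (_ : point_masses p = \bigcup_n [set x | n.+1%:R^-1%:E < p [set x]]).
  apply: bigcup_countable => // n _; apply: finite_set_countable.
  (* Already n + 2 points of mass above 1 / (n + 1) would have total mass above 1. *)
  apply: contrapT => /(infinite_set_fset n.+2)[B BA Bn].
  have : p (\big[setU/set0]_(x <- finmap.enum_fset B) [set x]) <= 1 by exact: probability_le1 (bigsetU_measurable _ _).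
  rewrite measure_fbigsetU//; last by move=> x y _ _ [z [/= -> ->]].
  apply/negP; rewrite -ltNge.
  apply: (@lt_le_trans _ _ (\sum_(x <- finmap.enum_fset B) n.+1%:R^-1%:E)); last first.
    by rewrite big_seq [leRHS]big_seq; apply: lee_sum => x xB; apply/ltW/BA.
  rewrite sumEFin lte_fin big_const_seq count_predT iter_addr_0 -[ltRHS]mulr_natr.
  rewrite mulrC ltr_pdivlMr// mul1r ltr_nat.
  exact: leq_trans Bn.
apply/seteqP; split => x /=; last first.
  by move=> [n _ /=]; apply: lt_trans; rewrite lte_fin.
rewrite /point_masses/= => px.
have fx : p [set x] \is a fin_num by exact: fin_num_measure.
have px0 : (0 < fine (p [set x]))%R by rewrite -lte_fin fineK.
have [n _ /(_ n (leqnn _)) ne] := near_infty_natSinv_lt (PosNum px0).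
by exists n => //=; rewrite -(fineK fx) lte_fin.
Qed.

Lemma measurable_point_masses (p : probability S R) : measurable (point_masses p).
Proof. by apply: countable_measurable => //; exact: countable_point_masses. Qed.

(** The set of atoms is itself a maximiser: what a countable set has outside it is a countable union
    of null points. *)
Lemma countable_ideal_mass (p : probability S R) :
  ideal_mass countable_ideal p = p (point_masses p).
Proof.
apply/eqP; rewrite eq_le ideal_mass_ub ?andbT; last first.
  by split; [exact: countable_point_masses|exact: measurable_point_masses].
apply: ge_ereal_sup => _ [C [cC mC] <-].
have mD : measurable (C `\` point_masses p).
  by apply: measurableD => //; exact: measurable_point_masses.
have CD0 : p (C `\` point_masses p) = 0.
  have [->|/set0P[r Cr]] := eqVneq (C `\` point_masses p) set0; first exact: measure0.
  have cD : countable (C `\` point_masses p).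
    exact: sub_countable (subset_card_le (@subDsetl _ _ _)) cC.
  have /pcard_geP/surjPex[f fs] := cD.
  apply/eqP; rewrite eq_le measure_ge0 andbT.
  (* The enumeration [f] may take values outside the set, hence the intersection. *)
  pose F n := (C `\` point_masses p) `&` [set f n].
  have F0 n : measurable (F n) /\ p (F n) = 0.
    have [fn|fn] := pselect ((C `\` point_masses p) (f n)).
      rewrite /F setIC set1I mem_set//; split => //; apply/eqP.
      by case: fn => _ /negP; rewrite -leNgt eq_le measure_ge0 andbT.
    rewrite (_ : F n = set0) ?measure0//.
    by apply/seteqP; split => // x [Dx /= xf]; apply: fn; rewrite -xf.
  apply: (@le_trans _ _ (\sum_(n <oo) p (F n))); last first.
    by rewrite eseries0// => n _ _; case: (F0 n).
  apply: measure_sigma_subadditive => //; first by move=> n; case: (F0 n).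
  by move=> x Dx; have [n _ fn] := fs x Dx; exists n.
apply: (@le_trans _ _ (p (C `\` point_masses p `|` point_masses p))).
  apply: le_measure; rewrite ?inE//; first by apply: measurableU => //; exact: measurable_point_masses.
  by move=> x Cx /=; have [?|?] := pselect (point_masses p x); [right|left].
apply: le_trans (measureU2 _ _ _) _ => //; first exact: measurable_point_masses.
by rewrite -[leRHS]add0e; apply: leeD => //; rewrite -[leRHS]CD0.
Qed.

End countable_ideal.

(** * Description of the three classes by ideal masses, and measurability of these masses *)

Section countable_mass.
Context (R : realType) (d : measure_display) (S : measurableType d).
Local Open Scope ereal_scope.
Hypothesis m1 : forall x : S, measurable [set x].

Lemma discrete_probE (p : pprobability S R) :
  discrete_prob p <-> ideal_mass (@countable_ideal _ S) (p : probability S R) = 1.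
Proof.
split.
  move=> [C [cC mC pC]]; apply/eqP; rewrite eq_le ideal_mass_le1 ?andbT;
    last exact: sigma_ideal_countable.
  by rewrite -pC ideal_mass_ub.
have [N [cN mN] <- ?] := ideal_mass_attained (@sigma_ideal_countable _ S) (p : probability S R).
by exists N.
Qed.

Lemma nonatomic_probE (p : pprobability S R) :
  nonatomic_prob p <-> ideal_mass (@countable_ideal _ S) (p : probability S R) = 0.
Proof.
rewrite countable_ideal_mass//; split.
  move=> p0; rewrite (_ : point_masses _ = set0) ?measure0//.
  by apply/seteqP; split => // x; rewrite /point_masses/= p0 ltxx.
move=> p0 x; apply/eqP; rewrite eq_le measure_ge0 andbT -p0.
rewrite -countable_ideal_mass// ideal_mass_ub//; split => //.
Qed.

Lemma measurable_eval (U : set S) : measurable U ->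
  measurable_fun setT (fun p : pprobability S R => (p : probability S R) U).
Proof.
move=> mU.
exact: (measurable_kernel (kprobability (@measurable_id _ (pprobability S R) setT)) U mU).
Qed.

Context (A : nat -> set S) (genA : countably_generated A) (sepA : separating A).

Let cell N (x : S) := [set y | bits A N y == bits A N x].

Let mcell N x : measurable (cell N x).
Proof. by apply: (@measurable_bits _ _ A N (pred1 (bits A N x))) => i _; exact: generator_measurable. Qed.

Let cellE x : [set x] = \bigcap_N cell N x.
Proof.
apply/seteqP; split => [y -> N _|y H]; first by rewrite /cell/=.
apply: sepA => i; have := H i.+1 I; rewrite /cell/= => /eqP E.
have : nth false (bits A i.+1 y) i = nth false (bits A i.+1 x) i by rewrite E.
by rewrite !nth_bits// => Ek; split=> /asboolP; [rewrite Ek|rewrite -Ek] => /asboolP.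
Qed.

Lemma measurable_set1_generated (x : S) : measurable [set x].
Proof. by rewrite cellE; exact: bigcapT_measurable. Qed.

(** The cells around x decrease to the singleton, so an atom is recognised by a lower bound on the
    masses of countably many cells. *)
Let point_mass_lt (p : probability S R) x :
  0 < p [set x] <-> exists n, forall N, n.+1%:R^-1%:E < p (cell N x).
Proof.
have cv : p \o (cell ^~ x) @ \oo --> p [set x].
  rewrite cellE; apply: nonincreasing_cvg_mu => //.
  - by apply: le_lt_trans (probability_le1 _ _) _; rewrite ?ltry.
  - exact: bigcapT_measurable.
  move=> M N MN; apply/subsetPset => y; rewrite /cell/= => /eqP E'.
  by rewrite -(take_bits A y MN) -(take_bits A x MN) E'.
split.
  move=> px.
  have fx : p [set x] \is a fin_num by exact: fin_num_measure.
  have px0 : (0 < fine (p [set x]))%R by rewrite -lte_fin fineK.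
  have [n _ /(_ n (leqnn _)) ne] := near_infty_natSinv_lt (PosNum px0).
  exists n => N; apply: (@lt_le_trans _ _ (p [set x])).
    by rewrite -(fineK fx) lte_fin.
  by apply: le_measure; rewrite ?inE// cellE; exact: bigcap_inf.
move=> [n Hn].
apply: (@lt_le_trans _ _ n.+1%:R^-1%:E); first by rewrite lte_fin.
rewrite -(cvg_lim _ cv)//; apply: lime_ge; first by apply/cvg_ex; exists (p [set x]).
by apply: nearW => N; apply: ltW; exact: Hn.
Qed.

(** The mass is p of the set of atoms of p, that is, the p-measure of a section of [E]. It is
    measurable in p once [E] is jointly measurable, since the identity on probabilities is a
    kernel. *)
Lemma measurable_countable_mass : measurable_fun setT
  (fun p : pprobability S R => ideal_mass (@countable_ideal _ S) (p : probability S R)).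
Proof.
pose E := [set z : pprobability S R * S | 0 < (z.1 : probability S R) [set z.2]].
have mE : measurable E.
  (* At each level the cell of x is one of countably many, so the condition on it is a countable
     union of measurable rectangles. *)
  rewrite (_ : E = \bigcup_n \bigcap_N \bigcup_(s : seq bool)
    ([set p : pprobability S R | n.+1%:R^-1%:E < (p : probability S R) [set y | bits A N y == s]]
     `*` [set y | bits A N y == s])).
    apply: bigcupT_measurable => n; apply: bigcapT_measurable => N.
    apply: countable_bigcupT_measurable; first exact: countableP.
    move=> s; have ms : measurable [set y | bits A N y == s].
      by apply: (@measurable_bits _ _ A N (pred1 s)) => i _; exact: generator_measurable.
    apply: measurableX => //.
    rewrite -[X in measurable X]setTI; apply: emeasurable_fun_o_infty => //.
    exact: measurable_eval.
  apply/seteqP; split => -[p x]; rewrite /E/= => H.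
    have [n Hn] := (point_mass_lt p x).1 H.
    by exists n => // N _; exists (bits A N x) => //; split => //=; exact: Hn.
  have [n _ Hn] := H; apply/(point_mass_lt p x).
  by exists n => N; have [s _ [/= H1 /eqP H2]] := Hn N I; rewrite /cell H2.
have := @measurable_fun_xsection_finite_kernel _ _ _ _ _
  (kprobability (@measurable_id _ (pprobability S R) setT)) E.
rewrite inE => /(_ mE); apply: eq_measurable_fun => p _ /=.
rewrite countable_ideal_mass//; congr (p _).
by apply/seteqP; split => x; rewrite /xsection/= inE.
Qed.

Variable nu : probability S R.

(** Trades the supremum over null sets for countable quantifiers. Forwards, a maximal null set is
    approximated under nu + p. Backwards, by Borel-Cantelli, the upper limit of the chosen sets is
    nu-null while its p-mass is at least r + 1 / (j + 1). *)
Lemma null_mass_gt (p : probability S R) (r : R) :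
  r%:E < ideal_mass (null_ideal nu) p <->
  exists j, forall k, exists t, nu (cell_union A t) < (1 / (2 ^ k.+1)%:R)%:E /\
    (r + j.+1%:R^-1)%:E < p (cell_union A t).
Proof.
have mcu t : measurable (cell_union A t).
  by apply: measurable_cell_union; exact: generator_measurable.
split.
  move=> rp; have [N [mN N0] pN] := ideal_mass_attained (sigma_ideal_null nu) p.
  rewrite -pN in rp.
  have fN : p N \is a fin_num by exact: fin_num_measure.
  have e0 : (0 < (fine (p N) - r) / 2)%R.
    by rewrite divr_gt0// subr_gt0 -lte_fin fineK.
  have [j _ /(_ j (leqnn _)) je] := near_infty_natSinv_lt (PosNum e0).
  exists j => k.
  pose e := Num.min ((fine (p N) - r) / 2)%R (1 / (2 ^ k.+1)%:R)%R.
  have e1 : (0 < e)%R by rewrite lt_min e0 divr_gt0// ltr0n expn_gt0.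
  (* A single approximation under the sum keeps the nu-mass small and loses little p-mass. *)
  have addoo : measure_add nu p setT < +oo.
    by rewrite measure_addE [X in X + _]probability_setT [X in _ + X]probability_setT -EFinD ltry.
  have [t] := cell_union_approx genA addoo mN e1.
  rewrite -[X in X < _]/(measure_add nu p (N `+` cell_union A t)) measure_addE => Ht.
  have mY : measurable (N `+` cell_union A t).
    by apply: measurableU; exact: measurableD.
  exists t; split.
    apply: (@le_lt_trans _ _ (nu (N `|` (N `+` cell_union A t)))).
      apply: le_measure; rewrite ?inE//; first exact: measurableU.
      by move=> x Cx; have [Nx|Nx] := pselect (N x); [left|right;right].
    apply: le_lt_trans (measureU2 _ _ _) _ => //.
    rewrite [X in X + _]N0 add0e.
    apply: le_lt_trans (lt_le_trans Ht _); first by rewrite leeDl.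
    by rewrite lee_fin ge_min lexx orbT.
  have : p N <= p (cell_union A t) + p (N `+` cell_union A t).
    apply: le_trans (measureU2 _ _ _) => //.
    apply: le_measure; rewrite ?inE//; first exact: measurableU.
    by move=> x Nx; have [?|?] := pselect (cell_union A t x); [left|right;left].
  have : p (N `+` cell_union A t) < ((fine (p N) - r) / 2)%:E.
    apply: le_lt_trans (lt_le_trans Ht _); first by rewrite leeDr.
    by rewrite lee_fin ge_min lexx.
  have f1 : p (cell_union A t) \is a fin_num by exact: fin_num_measure.
  have f2 : p (N `+` cell_union A t) \is a fin_num by exact: fin_num_measure.
  rewrite -(fineK fN) -(fineK f1) -(fineK f2) -EFinD !(lte_fin,lee_fin) /=.
  move: je => /=; set u := (_^-1)%R; set v := fine (p N); set x := fine _; set y := fine _; lra.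
move=> [j Hj]; have [t Ht] := choice Hj.
pose F k := cell_union A (t k).
have mF k : measurable (F k) by exact: mcu.
pose L := lim_sup_set F.
have mL : measurable L.
  by apply: bigcapT_measurable => k; apply: bigcup_measurable.
have nuL : nu L = 0.
  apply: lim_sup_set_cvg0 => //.
  apply: (@le_lt_trans _ _ (\sum_(n <oo) (1 / (2 ^ n.+1)%:R)%:E)).
    by apply: lee_nneseries => // n _; apply: ltW; case: (Ht n).
  by apply: le_lt_trans (epsilon_trick0 xpredT ler01) _; rewrite ltry.
have pL : (r + j.+1%:R^-1)%:E <= p L.
  have : p (\bigcup_(k >= n) F k) @[n --> \oo] --> p L.
    apply: lim_sup_set_cvg => //.
    apply: (@le_lt_trans _ _ 1); last by rewrite ltry.
    by apply: probability_le1; exact: bigcup_measurable.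
  move=> cv; rewrite -(cvg_lim _ cv)//; apply: lime_ge.
    by apply/cvg_ex; exists (p L).
  apply: nearW => n; apply: (@le_trans _ _ (p (F n))); first by apply: ltW; case: (Ht n).
  apply: le_measure; rewrite ?inE//; first exact: bigcup_measurable.
  by move=> x Fx; exists n => /=.
apply: (@lt_le_trans _ _ (r + j.+1%:R^-1)%:E); first by rewrite lte_fin ltrDl.
by apply: (le_trans pL); apply: ideal_mass_ub.
Qed.

Lemma measurable_null_mass : measurable_fun setT
  (fun p : pprobability S R => ideal_mass (null_ideal nu) (p : probability S R)).
Proof.
apply: (measurability _ (ErealGenOInfty.measurableE R)) => _ /= -[_ [r ->] <-].
rewrite setTI preimage_itvoy.
rewrite (_ : [set p | _] = \bigcup_j \bigcap_k \bigcup_t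
  [set p : pprobability S R | nu (cell_union A t) < (1 / (2 ^ k.+1)%:R)%:E /\
    (r + j.+1%:R^-1)%:E < (p : probability S R) (cell_union A t)]).
  apply: bigcupT_measurable => j; apply: bigcapT_measurable => k.
  apply: countable_bigcupT_measurable; first exact: countableP.
  move=> t.
  have [nut|nut] := pselect (nu (cell_union A t) < (1 / (2 ^ k.+1)%:R)%:E); last first.
    by rewrite (_ : [set _ | _] = set0)//; apply/seteqP; split => // p [].
  rewrite (_ : [set _ | _] = setT `&` [set p : pprobability S R |
    (r + j.+1%:R^-1)%:E < (p : probability S R) (cell_union A t)]).
    apply: emeasurable_fun_o_infty => //; apply: measurable_eval.
    by apply: measurable_cell_union; exact: generator_measurable.
  by apply/seteqP; split => p [].
apply/seteqP; split => p /=.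
  move=> /null_mass_gt[j Hj]; exists j => // k _; have [t Ht] := Hj k; by exists t.
move=> [j _ Hj]; apply/null_mass_gt; exists j => k; have [t _ Ht] := Hj k I; by exists t.
Qed.

End countable_mass.

(** * Kernel based Dirichlet sequences *)

Lemma urn_mean_bits (R : realType) (theta v : R) (T : Type) (A : nat -> set T) n x :
  urn_mean (theta * v) theta (bits A n x) =
  smoothed_mean theta v (fun i => `[< A i x >]%:R) n.
Proof.
rewrite /urn_mean /smoothed_mean size_bits; congr ((_ + _) / _).
elim: n => [|n IH]; first by rewrite big_ord0.
by rewrite bitsS -cats1 count_cat natrD IH/= addn0 big_ord_recr.
Qed.

Lemma limn_einf_ge (R : realType) (u : (\bar R)^nat) c N0 :
  (forall N, (N0 <= N)%N -> c <= u N)%E -> (c <= limn_einf u)%E.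
Proof.
move=> cu; rewrite limn_einf_lim; apply: lime_ge; first exact: is_cvg_einfs.
exists N0 => // n /= Nn; apply: le_ereal_inf_tmp => _ [k /= nk <-].
by apply: cu; exact: leq_trans nk.
Qed.

Lemma limn_einf_le (R : realType) (u : (\bar R)^nat) c :
  (forall N, u N <= c)%E -> (limn_einf u <= c)%E.
Proof.
move=> cu; rewrite limn_einf_lim; apply: lime_le; first exact: is_cvg_einfs.
apply: nearW => n; apply: le_trans (cu n); apply: ereal_inf_lbound.
by exists n => /=.
Qed.

Section class_L.
Context (R : realType) (dO dS : measure_display).
Context (Omega : measurableType dO) (S : measurableType dS).
Context (P : probability Omega R) (X : nat -> {RV P >-> S}).
Context (nu : probability S R) (theta : R) (K : {mfun S >-> pprobability S R}).
Context (theta0 : 0 < theta) (G : set_system S) (sG : sub_sigma_field G).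
Context (KG : reg_cond_distr nu G K).
Context (X0 : forall A, measurable A -> distribution P (X 0%N) A = nu A).
Context (predX : forall n, (1 <= n)%N -> forall A, measurable A ->
  cond_prob P (history X n) (X n @^-1` A)
    (fun w => predictive nu theta K X n w A)).
Local Open Scope ereal_scope.

Let GmS C : G C -> measurable C. Proof. by case: sG => _; exact. Qed.

Let salgG : sigma_algebra setT G. Proof. by case: sG. Qed.

Let GT : G setT.
Proof. by case: salgG => G0 GC _; rewrite -(setD0 setT); exact: GC. Qed.

Let GC C : G C -> G (~` C).
Proof. by case: salgG => _ GC _ /GC; rewrite setTD. Qed.

(** * The kernel on its conditioning field, and the marginal laws *)

Lemma measurable_kernel_eval A : measurable A ->
  measurable_fun setT (fun x => (K x : probability S R) A).
Proof.
by move=> mA; exact: (measurableT_comp (measurable_eval (R := R) mA) (measurable_funPT K)).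
Qed.

Lemma kernel_disjoint0 C B : G C -> G B -> C `&` B = set0 ->
  {ae nu, forall x, B x -> (K x : probability S R) C = 0}.
Proof.
move=> HC HB CB; have [_ /(_ _ HB)] := KG (GmS HC).
rewrite CB measure0 => /esym int0.
have mK := measurable_funTS (measurable_kernel_eval (GmS HC)) : measurable_fun B _.
apply: (ae_eq_integral_abs nu (GmS HB) mK).1.
by rewrite -[RHS]int0; apply: eq_integral => x _; rewrite gee0_abs.
Qed.

(** Sets of the conditioning field are decided by x: K(x) is carried by whichever of [C] and its
    complement contains x. Each half is an instance of [kernel_disjoint0]. *)
Lemma kernel_indic C : G C ->
  {ae nu, forall x, (K x : probability S R) C = (\1_C x)%:E}.
Proof.
move=> HC.
have H1 := kernel_disjoint0 HC (GC HC) (setICr C).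
have H2 := kernel_disjoint0 (GC HC) HC (setICl C).
apply: filterS2 H1 H2 => x H1 H2; rewrite indicE.
have [Cx|Cx] := pselect (C x).
  rewrite mem_set//; have := H2 Cx; rewrite probability_setC; last exact: GmS.
  rewrite -(fineK (fin_num_measure (K x : probability S R) _ (GmS HC))) -EFinB => -[/eqP].
  by rewrite subr_eq0 => /eqP <-.
by rewrite memNset// H1.
Qed.

Lemma kernel_mean A : measurable A ->
  \int[nu]_x (K x : probability S R) A = nu A.
Proof. by move=> mA; have [_ /(_ _ GT)] := KG mA; rewrite setIT. Qed.

Lemma measurable_predictive n A : measurable A ->
  measurable_fun setT (fun w => predictive nu theta K X n w A).
Proof.
move=> mA; apply: emeasurable_funM => //; apply: emeasurable_funD => //.
apply: emeasurable_sum => i.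
exact: measurableT_comp (measurable_kernel_eval mA) (measurable_funPT (X i)).
Qed.

(** Strong induction: integrate the predictive formula over the whole space and use that averaging K
    under nu gives back nu. *)
Lemma law_X n A : measurable A -> P (X n @^-1` A) = nu A.
Proof.
elim/ltn_ind: n A => n IH A mA.
case: n IH => [|n] IH; first exact: X0.
have [_ _ /(_ setT)] := predX (ltn0Sn n) mA.
rewrite setIT => <-; last first.
  have [+ + _] := @smallest_sigma_algebra _ setT
    (\big[setU/set0]_(i < n.+1) preimage_set_system setT (X i) measurable).
  by move=> h0 hC; rewrite /history/g_sigma_preimage -[X in smallest _ _ X](setD0 setT); exact: hC.
have c0 : (0 < n.+1%:R + theta)%R by rewrite ltr_wpDl.
have mKX (i : nat) : measurable_fun setT (fun w => (K (X i w) : probability S R) A).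
  exact: measurableT_comp (measurable_kernel_eval mA) (measurable_funPT (X i)).
rewrite ge0_integralZr//=; first last.
- by rewrite lee_fin invr_ge0 ltW.
- move=> w _; apply: adde_ge0; first by rewrite mule_ge0// lee_fin ltW.
  by apply: sume_ge0.
- apply: emeasurable_funD => //; apply: emeasurable_sum => i; exact: mKX.
rewrite ge0_integralD//; first last.
- by apply: emeasurable_sum => i; exact: mKX.
- by move=> w _; apply: sume_ge0.
- by move=> w _; rewrite mule_ge0// lee_fin ltW.
rewrite integral_cst//. rewrite [X in _ * X + _]probability_setT mule1 ge0_integral_sum//.
rewrite (eq_bigr (fun=> nu A)); last first.
  move=> i _; rewrite -[RHS](kernel_mean mA).
  transitivity (\int[distribution P (X i)]_x (K x : probability S R) A).
    by rewrite ge0_integral_distribution//; exact: measurable_kernel_eval.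
  by apply: eq_measure_integral => B mB _; exact: IH.
have fA : nu A \is a fin_num by exact: fin_num_measure.
rewrite -(fineK fA) sumEFin -!(EFinM,EFinD); congr (_%:E).
rewrite sumr_const card_ord -mulr_natr; field; lra.
Qed.

Lemma ae_X (Q : S -> Prop) : {ae nu, forall x, Q x} ->
  {ae P, forall w, forall i, Q (X i w)}.
Proof.
move=> [N [mN N0 NQ]]; apply: ae_foralln => i.
exists (X i @^-1` N); split.
- by rewrite -[X in measurable X]setTI; exact: measurable_funPT.
- by rewrite -N0; exact: law_X.
- by move=> w /= Qw; apply: NQ.
Qed.

(** * Real-valued predictive probabilities and the colour words of the observations *)

Definition predR n w A : R :=
  smoothed_mean theta (fine (nu A)) (fun i => fine ((K (X i w) : probability S R) A)) n.

Lemma predictiveE n w A : measurable A -> predictive nu theta K X n w A = (predR n w A)%:E.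
Proof.
move=> mA; rewrite /predictive /predR /smoothed_mean EFinM EFinD EFinM fineK ?fin_num_measure//.
rewrite -sumEFin; congr ((_ + _) * _); apply: eq_bigr => i _.
by rewrite fineK ?fin_num_measure.
Qed.

(** With events indexed by time, [bits (hits C) n w] is the 0-1 word recording which of the first n
    observations fall in [C]. *)
Definition hits C (i : nat) : set Omega := X i @^-1` C.

Local Notation colour C := (theta * fine (nu C))%R.

Lemma colour_ge0 C : (0 <= colour C)%R.
Proof. by rewrite mulr_ge0 ?fine_ge0// ltW. Qed.

Lemma fine_prob_le1 (p : probability S R) C : measurable C -> (fine (p C) <= 1)%R.
Proof.
by move=> mC; rewrite -lee_fin fineK ?probability_le1 ?fin_num_measure.
Qed.

Lemma colour_le C : measurable C -> (colour C <= theta)%R.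
Proof. by move=> mC; rewrite ler_piMr ?fine_prob_le1// ltW. Qed.

Lemma predR_urn C : G C ->
  {ae P, forall w, forall n, predR n w C = urn_mean (colour C) theta (bits (hits C) n w)}.
Proof.
move=> HC; apply: filterS (ae_X (kernel_indic HC)) => w Kw n.
rewrite /predR /smoothed_mean /urn_mean size_bits; congr ((_ + _) / _)%R.
elim: n => [|n IH]; first by rewrite big_ord0.
rewrite bitsS -cats1 count_cat natrD/= addn0 big_ord_recr/= IH Kw/= indicE.
by congr (_ + _%:R)%R.
Qed.

Let bits_event C n s := [set w | bits (hits C) n w == s].

Let mhits C i : measurable C -> measurable (hits C i).
Proof. by move=> mC; rewrite -[X in measurable X]setTI; exact: measurable_funPT. Qed.

Lemma measurable_bits_event C n s : measurable C -> measurable (bits_event C n s).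
Proof. by move=> mC; apply: (@measurable_bits _ _ _ _ (pred1 s)) => i _; exact: mhits. Qed.

Let history_bits_event C n s : measurable C -> history X n (bits_event C n s).
Proof.
move=> mC.
apply: (@measurable_bits _ (g_sigma_algebraType
  (\big[setU/set0]_(i < n) preimage_set_system setT (X i) measurable))
  (hits C) n (pred1 s)).
move=> i ni; apply: sub_sigma_algebra.
rewrite -(bigcup_mkord n (fun i => preimage_set_system setT (X i) measurable)).
by exists i => //=; exists C => //; rewrite setTI.
Qed.

Lemma bits_event_next C n s : G C -> size s = n ->
  P (bits_event C n s `&` hits C n) =
  (urn_mean (colour C) theta s)%:E * P (bits_event C n s).
Proof.
move=> HC sn; have mC := GmS HC.
(* The predictive formula is available from one observation on; the empty word is settled by the law
   of the first variable. *)
case: n sn => [|n] sn.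
  rewrite (size0nil sn) (_ : bits_event _ _ _ = setT); last first.
    by apply/seteqP; split => // w; rewrite /bits_event/=.
  rewrite setTI law_X// probability_setT mule1 /urn_mean/= addr0 add0r.
  by rewrite mulrAC mulfV ?gt_eqF// mul1r fineK// fin_num_measure.
have [_ _ /(_ (bits_event C n.+1 s))] := predX (ltn0Sn n) mC.
rewrite setIC => <-; last exact: history_bits_event.
have mB := @measurable_bits_event C n.+1 s mC.
rewrite -integral_cst//; apply: ae_eq_integral => //.
  exact: measurable_funTS (measurable_predictive _ mC).
apply: filterS (predR_urn HC) => w Hw; rewrite /bits_event/= => /eqP <-.
by rewrite predictiveE// Hw.
Qed.

Lemma law_bits C n s : G C -> size s = n ->
  P (bits_event C n s) =
  (urn_expect (colour C) theta n (fun b => (b == s)%:R))%:E.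
Proof.
move=> HC; elim: n s => [|n IH] s.
  move=> /size0nil ->; rewrite (_ : bits_event _ _ _ = setT) ?probability_setT//.
  by apply/seteqP; split => // w; rewrite /bits_event/=.
case/lastP: s => [//|s x]; rewrite size_rcons => -[sn].
have mC := GmS HC; have mB := @measurable_bits_event C n s mC.
have a0 := colour_ge0 C; have a1 := colour_le mC.
have BE : bits_event C n.+1 (rcons s x) =
    if x then bits_event C n s `&` hits C n else bits_event C n s `\` hits C n.
  apply/seteqP; split => w; rewrite /bits_event/= bitsS eqseq_rcons.
    move=> /andP[bs /eqP <-]; case: asboolP => h; split => //.
  by case: x => -[bs h]; rewrite [bits _ _ _ == _]bs/=; [rewrite asboolT|rewrite asboolF].
have E : (urn_expect (colour C) theta n.+1 (fun b => (b == rcons s x)%:R) =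
    (if x then urn_mean (colour C) theta s else 1 - urn_mean (colour C) theta s) *
    urn_expect (colour C) theta n (fun b => (b == s)%:R))%R.
  rewrite -urn_expectZ//=; congr (urn_expect _ _ _ _); apply/funext => b.
  rewrite /urn_step !eqseq_rcons.
  have [->|] := eqVneq b s; last by rewrite !andFb !mulr0 addr0.
  by case: x {BE} => /=; rewrite !mulr1 mulr0 ?addr0 ?add0r.
rewrite E EFinM -IH// BE; case: x {E BE}; first exact: bits_event_next.
rewrite measureD//; [|exact: mhits|by rewrite ltey_eq fin_num_measure].
rewrite [X in _ - X = _]bits_event_next// EFinB muleBl ?mul1e//.
by rewrite fin_num_measure.
Qed.

(** Bridge from integrals to the recursion: decompose over the words of length [n], whose
    probabilities are those of the urn. *)
Lemma expect_bits C n f : G C -> (forall b, size b = n -> (0 <= f b)%R) ->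
  \int[P]_w (f (bits (hits C) n w))%:E = (urn_expect (colour C) theta n f)%:E.
Proof.
move=> HC f0; have mC := GmS HC.
have a0 := colour_ge0 C; have a1 := colour_le mC.
have fE b : size b = n -> f b = (\sum_(s : n.-tuple bool) f s * (b == s)%:R)%R.
  move=> /eqP bn; rewrite (bigD1 (Tuple bn))//= eqxx mulr1 big1 ?addr0// => s.
  rewrite -val_eqE/= eq_sym => /negbTE bs; by rewrite bs mulr0.
transitivity (\int[P]_w (\sum_(s : n.-tuple bool) (f s)%:E * (\1_(bits_event C n s) w)%:E)).
  apply: eq_integral => w _; rewrite fE ?size_bits// -sumEFin.
  apply: eq_bigr => s _; rewrite -EFinM indicE; congr (_ * (nat_of_bool _)%:R)%:E.
  by apply/idP/idP; rewrite inE.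
have mI s : measurable_fun setT (fun w => (\1_(bits_event C n s) w)%:E : \bar R).
  by apply/measurable_EFinP; apply: measurable_indic; exact: measurable_bits_event.
rewrite ge0_integral_sum//; last 2 first.
- by move=> s; apply: emeasurable_funM => //; exact: mI.
- by move=> s w _; rewrite mule_ge0// ?lee_fin// f0// size_tuple.
transitivity (\sum_(s : n.-tuple bool) (f s)%:E * P (bits_event C n s)).
  apply: eq_bigr => s _; rewrite ge0_integralZl//; last by rewrite lee_fin f0// size_tuple.
  by rewrite integral_indic// ?setIT//; exact: measurable_bits_event.
transitivity (\sum_(s : n.-tuple bool)
    (urn_expect (colour C) theta n (fun b => f s * (b == s)%:R)%R)%:E).
  apply: eq_bigr => s _.
  rewrite [RHS](_ : _ = (f s * urn_expect (colour C) theta n (fun b => (b == s)%:R))%:E).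
    by rewrite EFinM law_bits ?size_tuple.
  by rewrite urn_expectZ.
by rewrite sumEFin -urn_expect_sum//; congr (_%:E); apply: eq_urn_expect => // b bn; rewrite -fE.
Qed.

(** * Variation of the predictive laws on the cells of sigma(K) *)

Context (A : nat -> set S) (genA : countably_generated A).

Let measurable_cu t : measurable (cell_union A t).
Proof. by apply: measurable_cell_union; exact: generator_measurable. Qed.

(* Generators of sigma(K), over an enumeration of the pairs (algebra set,
   rational); the numbers that code no pair get the empty set. *)
Definition kernel_gens (i : nat) : set S :=
  if unpickle i is Some (t, q) then
    [set x | (K x : probability S R) (cell_union A t) < (ratr q)%:E]
  else set0.

Lemma kernel_gensG i : G (kernel_gens i).
Proof.
rewrite /kernel_gens; case: unpickle => [[t q]|]; last by case: salgG.
have [+ _] := KG (measurable_cu t).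
move=> /(_ `]-oo, (ratr q)%:E[%classic (emeasurable_itv _)).
by rewrite preimage_itvNyo.
Qed.

(** Rational thresholds separate the values of K on the generating algebra; measures that agree on
    this algebra are equal. *)
Lemma kernel_gens_separate x y :
  (forall i, kernel_gens i x <-> kernel_gens i y) ->
  forall B, measurable B -> (K x : probability S R) B = (K y : probability S R) B.
Proof.
move=> H.
have half x' y' : (forall i, kernel_gens i x' <-> kernel_gens i y') -> forall t,
    (K x' : probability S R) (cell_union A t) <= (K y' : probability S R) (cell_union A t).
  move=> H' t; rewrite leNgt; apply/negP.
  have fx : (K x' : probability S R) (cell_union A t) \is a fin_num by exact: fin_num_measure.
  have fy : (K y' : probability S R) (cell_union A t) \is a fin_num by exact: fin_num_measure.
  rewrite -(fineK fx) -(fineK fy) lte_fin => /rat_in_itvoo[q]; rewrite in_itv/= => /andP[q1 q2].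
  have := (H' (pickle (t, q))).2; rewrite /kernel_gens pickleK/=.
  rewrite -(fineK fx) -(fineK fy) !lte_fin => /(_ q1); apply/negP.
  by rewrite -leNgt ltW.
apply: (measure_unique (range (cell_union A)) (fun=> setT)).
- exact: cell_union_generates.
- exact: cell_union_setI.
- move=> _; have [t0 t0E] := cell_union0 A; have [t tE] := cell_unionC A t0.
  by exists t => //; rewrite tE t0E setC0.
- by rewrite bigcup_const.
- move=> _ [t _ <-]; apply/eqP; rewrite eq_le; apply/andP; split; first exact: half.
  by apply: half => i; split => ?; apply/H.
- by move=> _; apply: le_lt_trans (probability_le1 _ _) _; rewrite ?ltry.
Qed.

Definition kernel_cell N (s : N.-tuple bool) : set S :=
  [set x | bits kernel_gens N x == s].

Lemma kernel_cellG N (s : N.-tuple bool) : G (kernel_cell s).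
Proof.
rewrite -(sigma_algebra_id salgG).
apply: (@measurable_bits _ (g_sigma_algebraType G) kernel_gens N (pred1 (tval s))) => i _.
by apply: sub_sigma_algebra; exact: kernel_gensG.
Qed.

Lemma sum_kernel_cell N : (\sum_(s : N.-tuple bool) fine (nu (kernel_cell s)) = 1)%R.
Proof.
have mc (s : N.-tuple bool) := GmS (kernel_cellG s).
apply/EFin_inj; rewrite -sumEFin.
transitivity (\int[nu]_x (\sum_(s : N.-tuple bool) (\1_(kernel_cell s) x)%:E)).
  rewrite ge0_integral_sum//; last first.
  - by move=> s; apply/measurable_EFinP; exact: measurable_indic.
  by apply: eq_bigr => s _; rewrite integral_indic// setIT fineK// fin_num_measure.
rewrite (_ : (fun x => _) = cst 1); first by rewrite integral_cst// mul1e; exact: probability_setT.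
apply/funext => x /=.
have sx : size (bits kernel_gens N x) == N by rewrite size_bits.
rewrite (bigD1 (Tuple sx))//= big1 ?adde0.
  by rewrite indicE mem_set// /kernel_cell/=.
move=> s; rewrite -val_eqE/= => /negP xs; rewrite indicE memNset// => /eqP E.
by apply: xs; rewrite E.
Qed.

(** Almost surely the l1 distance between the predictive laws at times m and n on the cells of level
    [N], since these cells belong to [G]. Expressed through colour words, its mean is computable. *)
Definition cell_variation N m n w : R :=
  (\sum_(s : N.-tuple bool)
    let b := bits (hits (kernel_cell s)) n w in
    `|urn_mean (colour (kernel_cell s)) theta b -
      urn_mean (colour (kernel_cell s)) theta (take m b)|)%R.

Lemma cell_variation_ge0 N m n w : (0 <= cell_variation N m n w)%R.
Proof. exact: sumr_ge0. Qed.

Lemma measurable_bits_fun C n (f : seq bool -> R) : measurable C ->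
  measurable_fun setT (fun w => f (bits (hits C) n w)).
Proof.
move=> mC _ B mB; rewrite setTI.
rewrite (_ : _ @^-1` _ = [set w | f (bits (hits C) n w) \in B]).
  by apply: (@measurable_bits _ _ (hits C) n (fun b => f b \in B)) => i _; exact: mhits.
by apply/seteqP; split => w /=; rewrite inE.
Qed.

Lemma measurable_cell_variation N m n :
  measurable_fun setT (cell_variation N m n).
Proof.
apply: measurable_sum => s.
exact: (measurable_bits_fun n (fun b => `|urn_mean (colour (kernel_cell s)) theta b -
      urn_mean (colour (kernel_cell s)) theta (take m b)|)%R (GmS (kernel_cellG s))).
Qed.

Lemma expect_cell_variation N m n (l : R) : (m <= n)%N -> (0 < l)%R ->
  \int[P]_w (cell_variation N m n w)%:E <=
  (2 * theta / (m%:R + theta) +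
  (l * (1 / (m%:R + theta)) +
   l^-1 * \sum_(j < m) theta / (j%:R + theta)) / 2)%:E.
Proof.
move=> mn l0.
pose f (s : N.-tuple bool) b := (`|urn_mean (colour (kernel_cell s)) theta b -
      urn_mean (colour (kernel_cell s)) theta (take m b)|)%R.
rewrite /cell_variation.
under eq_integral do rewrite -sumEFin.
rewrite ge0_integral_sum//; last first.
  by move=> s; apply/measurable_EFinP; exact: (measurable_bits_fun n (f s) (GmS (kernel_cellG s))).
set Bd := (2 * _ / _ + _)%R.
(* The bound of [urn_mean_diff] is linear in the mass of the cell, and these masses sum to 1; this
   makes the result independent of [N]. *)
apply: (@le_trans _ _ (\sum_(s : N.-tuple bool) (fine (nu (kernel_cell s)) * Bd)%:E)).
  apply: lee_sum => s _.
  have fs0 b : size b = n -> (0 <= f s b)%R by rewrite /f.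
  rewrite (_ : \int[P]_w _ = (urn_expect (colour (kernel_cell s)) theta n (f s))%:E); last first.
    by rewrite -(expect_bits (kernel_cellG s) fs0).
  rewrite lee_fin.
  have a0 := colour_ge0 (kernel_cell s); have a1 := colour_le (GmS (kernel_cellG s)).
  apply: le_trans (urn_mean_diff a0 a1 theta0 mn l0) _.
  rewrite /Bd; set u := fine _; set S1 := (\sum_(j < m) theta / _)%R.
  have -> : (\sum_(j < m) theta * u / (j%:R + theta) = u * S1)%R.
    by rewrite mulr_sumr; apply: eq_bigr => j _; rewrite [in LHS](mulrC theta) mulrA.
  have m0 : (0 < m%:R + theta)%R by rewrite ltr_wpDl.
  rewrite le_eqVlt; apply/orP; left; apply/eqP.
  by field; rewrite !gt_eqF.
by rewrite sumEFin -mulr_suml sum_kernel_cell mul1r.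
Qed.

(** The lower limit over the levels always exists in the extended reals, and Fatou's lemma passes
    the uniform bound on the means to it. *)
Definition limit_variation k w : \bar R :=
  limn_einf (fun N => (cell_variation N (k.+1 ^ 8) (k.+2 ^ 8) w)%:E).

Lemma limit_variation_ge0 k w : 0 <= limit_variation k w.
Proof. by apply: (limn_einf_ge (N0 := 0%N)) => N _; rewrite lee_fin cell_variation_ge0. Qed.

Lemma measurable_limit_variation k : measurable_fun setT (limit_variation k).
Proof.
rewrite /limit_variation /limn_einf; apply: measurableT_comp => //.
apply: measurable_fun_limn_esup => N; apply: measurableT_comp => //.
by apply/measurable_EFinP; exact: measurable_cell_variation.
Qed.

Lemma expect_limit_variation k :
  \int[P]_w limit_variation k w <= (urn_rate theta k)%:E.
Proof.
apply: le_trans (fatou _ _ _ _) _ => //.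
- by move=> N; apply/measurable_EFinP; exact: measurable_cell_variation.
- by move=> N w _; rewrite lee_fin cell_variation_ge0.
apply: limn_einf_le => N.
apply: le_trans (expect_cell_variation N (l := urn_weight R k) _ _) _.
- by rewrite leq_exp2r.
- by rewrite /urn_weight exprn_gt0.
by rewrite lee_fin; exact: urn_rateP.
Qed.

Lemma limit_variation_summable :
  {ae P, forall w, \sum_(k <oo) limit_variation k w < +oo}.
Proof.
pose f w := \sum_(k <oo) limit_variation k w.
have f0 w : 0 <= f w by apply: nneseries_ge0 => k _ _; exact: limit_variation_ge0.
have mf : measurable_fun setT f.
  apply: (@ge0_emeasurable_sum _ _ _ _ (fun k w => limit_variation k w) xpredT).
    by move=> k w _ _; exact: limit_variation_ge0.
  by move=> k _; exact: measurable_limit_variation.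
have intf : P.-integrable setT f.
  apply/integrableP; split => //.
  under eq_integral do rewrite gee0_abs//.
  rewrite integral_nneseries//; last 2 first.
  - exact: measurable_limit_variation.
  - by move=> k w _; exact: limit_variation_ge0.
  apply: (@le_lt_trans _ _ (2 * (2 + 3 * theta))%:E); last by rewrite ltry.
  apply: lime_le.
    by apply: is_cvg_nneseries => k _ _; apply: integral_ge0 => w _; exact: limit_variation_ge0.
  apply: nearW => n; rewrite big_mkord.
  apply: (@le_trans _ _ (\sum_(k < n) (urn_rate theta k)%:E)).
    by apply: lee_sum => k _; exact: expect_limit_variation.
  by rewrite sumEFin lee_fin sum_urn_rate.
apply: filterS (integrable_ae measurableT intf) => w /(_ I).
by rewrite ge0_fin_numE.
Qed.

Let fine01 (p : probability S R) C : measurable C -> (0 <= fine (p C) <= 1)%R.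
Proof. by move=> mC; rewrite fine_ge0//= fine_prob_le1. Qed.

(** Holds at every w with finite [limit_variation], for all sets [B] at once, so the exceptional
    event does not depend on [B]. *)
Lemma predR_block w k B : measurable B -> limit_variation k w \is a fin_num ->
  (`|predR (k.+2 ^ 8) w B - predR (k.+1 ^ 8) w B| <=
   urn_rate theta k + fine (limit_variation k w))%R.
Proof.
move=> mB fl.
(* The prior term of [smoothed_mean_classes] is half of the first term in [urn_rateP]. *)
have rk : (theta / ((k.+1 ^ 8)%:R + theta) <= urn_rate theta k)%R.
  apply: le_trans (urn_rateP k theta0).
  have S0 : (0 <= (k.+1 ^ 8)%:R :> R)%R by [].
  have W0 : (0 < urn_weight R k)%R by rewrite /urn_weight exprn_gt0.
  have Q0 : (0 <= \sum_(j < k.+1 ^ 8) theta / (j%:R + theta))%R.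
    by apply: sumr_ge0 => j _; rewrite divr_ge0 ?addr_ge0// ltW.
  rewrite -[leLHS]addr0; apply: lerD; last first.
    rewrite divr_ge0// addr_ge0// mulr_ge0 ?invr_ge0 ?divr_ge0 ?addr_ge0// ?ltW//.
  by apply: ler_wpM2r; [rewrite invr_ge0 addr_ge0// ltW|move: theta0; lra].
(* From a level depending on w on, observations in the same cell have the same K; the lower limit
   sees only such levels. *)
have [N0 HN0] := bits_separate kernel_gens (fun i : 'I_(k.+2 ^ 8) => X i w).
suff : (`|predR (k.+2 ^ 8) w B - predR (k.+1 ^ 8) w B| - theta / ((k.+1 ^ 8)%:R + theta))%:E
   <= limit_variation k w.
  by rewrite -[leRHS]fineK// lee_fin; lra.
apply: (limn_einf_ge (N0 := N0)) => N NN; rewrite lee_fin lerBlDl.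
pose c i : N.-tuple bool := Tuple (introT eqP (size_bits kernel_gens N (X i w))).
have mn : (k.+1 ^ 8 <= k.+2 ^ 8)%N by rewrite leq_exp2r.
apply: le_trans (@smoothed_mean_classes R theta theta0 _ c _ _
  (fun s => fine (nu (kernel_cell s))) _ _ _ _ _ _ _ mn) _.
- exact: fine01.
- by move=> i; exact: fine01.
- by move=> s; rewrite fine_ge0.
- exact: sum_kernel_cell.
- move=> i j ni nj /(congr1 val)/= cij.
  rewrite (@kernel_gens_separate (X i w) (X j w))//.
  exact: (HN0 N NN (Ordinal ni) (Ordinal nj) cij).
rewrite lerD2l /cell_variation; apply: ler_sum => s _; cbv zeta; rewrite take_bits// !urn_mean_bits.
by rewrite le_eqVlt; apply/orP; left; apply/eqP; congr (`|_ - _|)%R;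
  congr (smoothed_mean _ _ _ _); apply/funext => i;
  congr ((nat_of_bool _)%:R)%R; rewrite -val_eqE/=;
  apply/idP/idP => [/eqP E|/asboolP]//; apply/asboolP; rewrite /hits /kernel_cell/= E.
Qed.

Lemma predR_uniform_cauchy : {ae P, forall w, forall e : R, (0 < e)%R ->
  exists M, forall n, (M <= n)%N -> forall B, measurable B ->
    (`|predR n w B - predR M w B| <= e)%R}.
Proof.
apply: filterS limit_variation_summable => w sw e e0.
have fin_lv k : limit_variation k w \is a fin_num.
  rewrite ge0_fin_numE ?limit_variation_ge0//; apply: le_lt_trans sw.
  apply: le_trans (nneseries_lim_ge k.+1 _); last by move=> *; exact: limit_variation_ge0.
  rewrite big_mkord big_ord_recr/= leeDr// sume_ge0// => i _; exact: limit_variation_ge0.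
have [|||||M HM] := @smoothed_mean_uniform_cauchy R theta theta0 {B : set S | measurable B}
  (fun B => fine (nu (sval B))) (fun B i => fine ((K (X i w) : probability S R) (sval B)))
  (fun k => urn_rate theta k + fine (limit_variation k w))%R
  (2 * (2 + 3 * theta) + fine (\sum_(k <oo) limit_variation k w))%R _ _ _ _ _ e e0.
- by move=> [B mB]; exact: fine01.
- by move=> [B mB] i; exact: fine01.
- move=> k; rewrite addr_ge0 ?fine_ge0 ?limit_variation_ge0//.
  by rewrite /urn_rate divr_ge0 ?exprn_ge0//; move: theta0; lra.
- move=> n; rewrite big_split/=; apply: lerD; first exact: sum_urn_rate.
  have sfin : \sum_(k <oo) limit_variation k w \is a fin_num.
    rewrite ge0_fin_numE//; apply: nneseries_ge0 => k _ _; exact: limit_variation_ge0.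
  rewrite -lee_fin (fineK sfin) -sumEFin.
  apply: le_trans (nneseries_lim_ge n _); last by move=> *; exact: limit_variation_ge0.
  by rewrite big_mkord; apply: lee_sum => k _; rewrite fineK.
- by move=> [B mB] k; exact: predR_block.
by exists M => n Mn B mB; exact: (HM n Mn (exist _ B mB)).
Qed.

(** * Convergence to the directing measure in total variation *)

Context (mu : {RV P >-> pprobability S R}) (mulim : directing_measure X mu).

Lemma measurable_mu_eval B : measurable B ->
  measurable_fun setT (fun w => (mu w : probability S R) B).
Proof.
by move=> mB; exact: (measurableT_comp (measurable_eval (R := R) mB) (measurable_funPT mu)).
Qed.

(** The explicit formula is a version of the conditional probabilities, so the second limit in
    [directing_measure] applies to it. *)
Lemma predR_cvg B : measurable B ->
  {ae P, forall w, predR n w B @[n --> \oo] --> fine ((mu w : probability S R) B)}.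
Proof.
move=> mB; have [_ /(_ (fun n w => predictive nu theta K X n w B))] := mulim mB.
move=> /(_ (fun n n1 => predX n1 mB)); apply: filterS => w.
rewrite (_ : (fun n => _) = EFin \o (fun n => predR n w B)); last first.
  by apply/funext => n; rewrite /= predictiveE.
by rewrite -[X in _ --> X]fineK ?fin_num_measure// => /fine_cvgP[].
Qed.

Lemma prob_diff_setY (p : probability S R) B C : measurable B -> measurable C ->
  (`|fine (p B) - fine (p C)| <= fine (p (B `+` C)))%R.
Proof.
move=> mB mC.
have mY : measurable (B `+` C) by apply: measurableU; exact: measurableD.
have H D F : measurable D -> measurable F -> D `<=` F `|` (B `+` C) ->
    (fine (p D) <= fine (p F) + fine (p (B `+` C)))%R.
  move=> mD mF DF; rewrite -lee_fin EFinD !fineK ?fin_num_measure//.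
  apply: le_trans (measureU2 _ _ _) => //.
  by apply: le_measure; rewrite ?inE//; exact: measurableU.
have h1 : (fine (p B) <= fine (p C) + fine (p (B `+` C)))%R.
  by apply: H => // x Bx; have [?|?] := pselect (C x); [left|right;left].
have h2 : (fine (p C) <= fine (p B) + fine (p (B `+` C)))%R.
  by apply: H => // x Cx; have [?|?] := pselect (B x); [left|right;right].
by rewrite ler_norml; apply/andP; split; lra.
Qed.

(** The predictive laws are already uniformly Cauchy; it remains to identify the limit. Almost
    surely it is mu on all codes at once, and an arbitrary [B] is compared with a code chosen for
    it. *)
Lemma predR_uniform : {ae P, forall w, forall e : R, (0 < e)%R ->
  exists M, forall n, (M <= n)%N -> forall B, measurable B ->
    (`|predR n w B - fine ((mu w : probability S R) B)| <= e)%R}.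
Proof.
have cvt : {ae P, forall w, forall t, predR n w (cell_union A t) @[n --> \oo] -->
    fine ((mu w : probability S R) (cell_union A t))}.
  (* Quantifying over natural numbers that may code a [t] reduces the claim to countably many almost
     sure events. *)
  have : {ae P, forall w, forall i, forall t, unpickle i = Some t ->
     predR n w (cell_union A t) @[n --> \oo] -->
    fine ((mu w : probability S R) (cell_union A t))}.
    apply: ae_foralln => i; case: unpickle => [t|]; last exact: aeW.
    by apply: filterS (predR_cvg (measurable_cu t)) => w cw _ [<-].
  by apply: filterS => w H t; apply: (H (pickle t)); rewrite pickleK.
apply: filterS2 predR_uniform_cauchy cvt => w cw cvt e e0.
have e4 : (0 < e / 4)%R by rewrite divr_gt0.
have e8 : (0 < e / 8)%R by rewrite divr_gt0.
have [M HM] := cw _ e8; exists M => n Mn B mB.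
(* This finite measure dominates mu, nu and every K(X_i) entering the predictive law at time M, so
   one code approximates [B] for both laws compared. *)
pose m := measure_add (mu w : probability S R)
  (measure_add nu (msum (fun i => (K (X i w) : probability S R)) M)).
have mE D : m D = (mu w : probability S R) D +
    (nu D + \sum_(i < M) (K (X i w) : probability S R) D).
  by rewrite /m measure_addE; congr (_ + _); exact: measure_addE.
have moo : m setT < +oo.
  rewrite mE.
  apply: lte_add_pinfty; first by rewrite [X in X < _]probability_setT ltry.
  apply: lte_add_pinfty; first by rewrite [X in X < _]probability_setT ltry.
  by apply: lte_sum_pinfty => i _; rewrite [X in X < _]probability_setT ltry.
have [t Ht] := cell_union_approx genA moo mB e4.
set C := cell_union A t in Ht.
have mC : measurable C by exact: measurable_cu.
have mY : measurable (B `+` C) by apply: measurableU; exact: measurableD.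
have small (p : probability S R) : p (B `+` C) <= m (B `+` C) ->
    (`|fine (p B) - fine (p C)| <= e / 4)%R.
  move=> pm; apply: le_trans (prob_diff_setY _ mB mC) _.
  by rewrite -lee_fin fineK ?fin_num_measure//; apply: le_trans pm (ltW Ht).
have a1 : (`|fine ((mu w : probability S R) B) - fine ((mu w : probability S R) C)| <= e / 4)%R.
  by apply: small; rewrite mE leeDl// adde_ge0// sume_ge0.
have a2 : (`|predR M w B - predR M w C| <= e / 4)%R.
  apply: smoothed_mean_le => //.
    apply: small; rewrite mE addeCA leeDl// adde_ge0// sume_ge0//.
  move=> i iM; apply: small; rewrite mE addeA (bigD1 (Ordinal iM))//= addeCA.
  by rewrite leeDl// !adde_ge0// sume_ge0.
have a3 : (`|predR M w C - fine ((mu w : probability S R) C)| <= e / 4)%R.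
  have /cvgrPdist_le/(_ _ e8)[M' _ HM'] := cvt t.
  have b1 := HM (maxn M M') (leq_maxl _ _) C mC.
  have b2 := HM' (maxn M M') (leq_maxr _ _).
  rewrite distrC in b1; rewrite distrC in b2.
  rewrite (_ : (predR M w C - _ = (predR M w C - predR (maxn M M') w C) +
    (predR (maxn M M') w C - fine ((mu w : probability S R) C)))%R); last by ring.
  by apply: le_trans (ler_normD _ _) _; move: b1 b2; rewrite -/C; lra.
have a4 := HM n Mn B mB.
rewrite (_ : (predR n w B - _ = (predR n w B - predR M w B) + (predR M w B - predR M w C) +
  (predR M w C - fine ((mu w : probability S R) C)) +
  (fine ((mu w : probability S R) C) - fine ((mu w : probability S R) B)))%R); last by ring.
rewrite distrC in a1.
apply: le_trans (ler_normD _ _) _; apply: le_trans (lerD (ler_normD _ _) (lexx _)) _.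
apply: le_trans (lerD (lerD (ler_normD _ _) (lexx _)) (lexx _)) _.
lra.
Qed.

Lemma predictive_tv_cvg : {ae P, forall w,
  ereal_sup [set `| predictive nu theta K X n w B - (mu w : probability S R) B |
            | B in measurable] @[n --> \oo] --> 0}.
Proof.
apply: filterS predR_uniform => w H.
pose u n := ereal_sup [set `| predictive nu theta K X n w B - (mu w : probability S R) B |
            | B in measurable].
have u0 n : 0 <= u n.
  apply: (@le_trans _ _ `|predictive nu theta K X n w set0 - (mu w : probability S R) set0|) => //.
  by apply: ereal_sup_ubound; exists set0.
have ue (e : R) : (0 < e)%R -> exists M, forall n, (M <= n)%N -> u n <= e%:E.
  move=> e0; have [M HM] := H e e0; exists M => n Mn.
  apply: ge_ereal_sup => _ [B mB <-].
  rewrite predictiveE// -(fineK (fin_num_measure (mu w : probability S R) _ mB)).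
  by rewrite -EFinB abse_EFin lee_fin; exact: HM.
have fe n (e : R) : u n <= e%:E -> u n \is a fin_num.
  by move=> ne; rewrite ge0_fin_numE// (le_lt_trans ne) ?ltry.
apply/fine_cvgP; split.
  have [M HM] := ue 1%R ltr01; exists M => // n /= Mn; exact: fe (HM n Mn).
apply/cvgrPdist_le => e e0; have [M HM] := ue e e0.
exists M => // n /= Mn; rewrite sub0r normrN ger0_norm; last exact: fine_ge0 (u0 n).
by rewrite -lee_fin fineK; [exact: HM|exact: fe (HM n Mn)].
Qed.

(** * The zero-one law *)

Lemma mass_mean_cvg (NN : set (set S)) : sigma_ideal NN ->
  {ae P, forall w,
    ((\sum_(i < n) fine (ideal_mass NN (K (X i w) : probability S R))) / (n%:R + theta))%R
      @[n --> \oo] --> fine (ideal_mass NN (mu w : probability S R))}.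
Proof.
move=> idN; apply: filterS predR_uniform => w H.
(* The maximal set found below depends on w; convergence on it follows because [predR_uniform] is
   uniform over all measurable sets. *)
pose p i : probability S R := if i is j.+1 then K (X j w) else mu w.
have [N NNN pN] := ideal_mass_common idN p.
have mN : measurable N by case: idN => _ + _; exact.
rewrite -(pN 0%N) /=.
have cvN : predR n w N @[n --> \oo] --> fine ((mu w : probability S R) N).
  apply/cvgrPdist_le => e e0; have [M HM] := H e e0.
  by exists M => // n /= Mn; rewrite distrC; exact: HM.
have cv : (predR n w N - theta / (n%:R + theta) * fine (nu N))%R @[n --> \oo] -->
    fine ((mu w : probability S R) N).
  rewrite -[X in _ --> X]subr0 -[X in _ --> (_ - X)%R](mul0r (fine (nu N))).
  by apply: cvgB => //; apply: cvgM; [exact: cvg_theta_div|exact: cvg_cst].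
rewrite (_ : (fun n => _) = (fun n => predR n w N - theta / (n%:R + theta) * fine (nu N))%R)//.
apply/funext => n; rewrite /predR /smoothed_mean.
have -> : (\sum_(i < n) fine (ideal_mass NN (K (X i w) : probability S R)) =
    \sum_(i < n) fine ((K (X i w) : probability S R) N))%R.
  by apply: eq_bigr => i _; exact: (congr1 fine (esym (pN i.+1))).
by rewrite mulrDl (mulrAC theta) addrAC subrr add0r.
Qed.

(** Where mu(C) = 0, the urn means tend to 0 and the k-th powers of their complements to 1. Fatou's
    lemma and [urn_escape] bound the probability of this event by a product that is arbitrarily
    small for suitable k. *)
Lemma mu_positive C : G C -> 0 < nu C ->
  {ae P, forall w, 0 < fine ((mu w : probability S R) C)}%R.
Proof.
move=> HC nuC0; have mC := GmS HC.
pose Z := [set w | (mu w : probability S R) C = 0].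
have mZ : measurable Z.
  rewrite (_ : Z = setT `&` (fun w => (mu w : probability S R) C) @^-1` [set 0]);
    last by rewrite setTI.
  exact: measurable_mu_eval.
have a0 := colour_ge0 C; have a1 := colour_le mC.
have a_gt0 : (0 < colour C)%R.
  by rewrite mulr_gt0// -lte_fin fineK// fin_num_measure.
have PZ k : P Z <= (\prod_(i < k) ((theta - colour C + i%:R) / (theta + i%:R)))%R%:E.
  pose f b : R := ((1 - urn_mean (colour C) theta b) ^+ k)%R.
  have f0 b : (0 <= f b)%R by rewrite exprn_ge0// subr_ge0 urn_mean_le1.
  have mf n : measurable_fun setT (fun w => (f (bits (hits C) n w))%:E).
    by apply/measurable_EFinP; exact: (measurable_bits_fun n f mC).
  rewrite -[X in P X]setIT -integral_indic//.
  apply: (@le_trans _ _ (\int[P]_w limn_einf (fun n => (f (bits (hits C) n w))%:E))).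
    apply: ae_ge0_le_integral => //.
    - by apply/measurable_EFinP; exact: measurable_indic.
    - by move=> w _; apply: (limn_einf_ge (N0 := 0%N)) => N _; rewrite lee_fin f0.
    - rewrite /limn_einf; apply: measurableT_comp => //.
      by apply: measurable_fun_limn_esup => N; apply: measurableT_comp.
    apply: filterS2 (predR_cvg mC) (predR_urn HC) => w cw uw _.
    rewrite indicE; have [wZ|wZ] := boolP (w \in Z); last first.
      by apply: (limn_einf_ge (N0 := 0%N)) => N _; rewrite lee_fin f0.
    have cv : (f (bits (hits C) n w))%:E @[n --> \oo] --> 1.
      apply: cvg_EFin; first by apply: nearW.
      rewrite /= -(expr1n R k) -[X in (X ^+ k)%R](subr0 1%R).
      have cv1 : (1 - urn_mean (colour C) theta (bits (hits C) n w))%R @[n --> \oo] -->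
          (1 - 0 : R)%R.
        apply: cvgB; first exact: cvg_cst.
        rewrite (_ : 0%R = fine ((mu w : probability S R) C)).
          by rewrite (_ : (fun n => _) = (fun n => predR n w C))//; apply/funext => n; rewrite uw.
        by move: wZ; rewrite inE /Z/= => ->.
      exact: (cvg_comp _ _ cv1 (@exprn_continuous _ k _)).
    by rewrite is_cvg_limn_einfE ?(cvg_lim _ cv)//; apply/cvg_ex; exists 1.
  apply: le_trans (fatou _ _ _ _) _ => //; first by move=> n w _; rewrite lee_fin f0.
  apply: limn_einf_le => n; rewrite (expect_bits (f := f) HC)// lee_fin.
  exact: urn_escape.
have PZ0 : P Z = 0.
  apply/eqP; rewrite eq_le measure_ge0 andbT; apply/lee_addgt0Pr => e e0.
  have [k Hk] := rising_ratio_cvg0 a0 a1 theta0 a_gt0 e0.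
  by rewrite add0e; apply: le_trans (PZ k) _; rewrite lee_fin ltW.
exists Z; split => // w /= /negP wZ.
have f0 := fin_num_measure (mu w : probability S R) _ mC.
move: wZ; rewrite -leNgt => wZ; apply/eqP; rewrite eq_le measure_ge0 andbT.
by rewrite -(fineK f0) lee_fin.
Qed.

(** The evaluations generate the sigma-field on probabilities, so their [G]-measurability carries
    over to K itself. *)
Lemma kernel_preimageG (B : set (pprobability S R)) : measurable B -> G (K @^-1` B).
Proof.
have [g0 gC gU] := salgG.
apply: (@smallest_sub _ _ _ [set B : set (pprobability S R) | G (K @^-1` B)]).
  split => /=.
  - by rewrite preimage_set0.
  - by move=> B' /gC; rewrite !setTD preimage_setC.
  - by move=> F HF; rewrite preimage_bigcup; exact: gU.
move=> _ [r _ [U mU <-]] /=; have [+ _] := KG mU.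
by move=> /(_ `]-oo, r%:E[%classic (emeasurable_itv _)); rewrite preimage_itvNyo.
Qed.

(** [D] is the zero set of [h]. If h(K) vanishes nu-almost everywhere, so do almost surely the
    averages and their limit h(mu). Otherwise h(K) exceeds some 1 / (j + 1) on a set of [G] with
    positive nu-mass, which mu charges almost surely, and this keeps h(mu) away from 0. *)
Lemma kernel_zero_one (h : pprobability S R -> R) (D : set (pprobability S R)) :
  measurable_fun setT h -> (forall p, 0 <= h p)%R -> (forall p, D p <-> h p = 0%R) ->
  {ae P, forall w, ((\sum_(i < n) h (K (X i w))) / (n%:R + theta))%R
      @[n --> \oo] --> h (mu w)} ->
  [/\ measurable [set w | D (mu w)],
      P [set w | D (mu w)] = 0 \/ P [set w | D (mu w)] = 1 &
      P [set w | D (mu w)] = 1 <-> {ae nu, forall x, D (K x)}].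
Proof.
move=> mh h0 Dh hlim.
pose Z := [set w | D (mu w)].
have mhm (B : set R) : measurable B -> measurable (h @^-1` B).
  by move=> mB; rewrite -[X in measurable X]setTI; exact: mh.
have mZ : measurable Z.
  rewrite (_ : Z = mu @^-1` (h @^-1` [set 0%R])).
    by rewrite -[X in measurable X]setTI; apply: measurable_funPT => //; exact: mhm.
  by apply/seteqP; split => w /= /Dh.
suff [[PZ1 HD]|[PZ0 HD]] : (P Z = 1 /\ {ae nu, forall x, D (K x)}) \/
    (P Z = 0 /\ ~ {ae nu, forall x, D (K x)}).
- by split => //; right.
- split => //; first by left.
  by rewrite [P _]PZ0; split => // /eqP; rewrite eq_sym onee_eq0.
have [HD|HD] := pselect {ae nu, forall x, D (K x)}.
  left; split => //.
  have : {ae P, forall w, Z w}.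
    apply: filterS2 hlim (ae_X HD) => w hw Dw; apply/Dh.
    apply/esym; apply: (norm_cvg_unique _ hw).
    rewrite (_ : (fun n => _) = cst 0%R); first exact: cvg_cst.
    apply/funext => n; rewrite big1 ?mul0r// => i _.
    by apply/Dh.
  move=> [N [mN N0 NZ]].
  have ZC0 : P (~` Z) = 0.
    apply/eqP; rewrite eq_le measure_ge0 andbT -N0.
    by apply: le_measure; rewrite ?inE//; exact: measurableC.
  by rewrite -(setCK Z) probability_setC ?ZC0 ?sube0//; exact: measurableC.
right; split => //.
pose E j := K @^-1` (h @^-1` [set y : R | (j.+1%:R^-1 < y)%R]).
have GE j : G (E j).
  apply: kernel_preimageG; apply: mhm.
  rewrite (_ : [set y | _] = `](j.+1%:R^-1 : R)%R, +oo[%classic); first exact: measurable_itv.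
  by apply/seteqP; split => y /=; rewrite in_itv/= andbT.
have [j nuE] : exists j, 0 < nu (E j).
  apply: contrapT => /forallNP nE; apply: HD.
  exists (\bigcup_j E j); split.
  - by apply: bigcupT_measurable => j; exact: GmS.
  - apply/eqP; rewrite eq_le measure_ge0 andbT.
    apply: (@le_trans _ _ (\sum_(n <oo) nu (E n))).
      apply: measure_sigma_subadditive => //; first by move=> j; exact: GmS.
      by apply: bigcupT_measurable => j; exact: GmS.
    rewrite eseries0// => n _ _; apply/eqP; rewrite eq_le measure_ge0 andbT leNgt.
    by apply/negP; exact: nE.
  - move=> x /= nD; have hx : (0 < h (K x))%R.
      by rewrite lt_neqAle h0 andbT eq_sym; apply/negP => /eqP /Dh.
    have [n _ /(_ n (leqnn _)) ne] := near_infty_natSinv_lt (PosNum hx).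
    by exists n.
have : {ae P, forall w, ~ Z w}.
  have mE := GmS (GE j).
  apply: filterS2 (filterI hlim (predR_cvg mE))
    (filterI (mu_positive (GE j) nuE) (predR_urn (GE j))).
  move=> w [hw cw] [mw uw] /Dh hmu; rewrite hmu in hw.
  have c0 : (0 < j.+1%:R^-1 :> R)%R by [].
  have Ec v : E j v -> (j.+1%:R^-1 <= h (K v) :> R)%R by move/ltW.
  move: c0 Ec; set c : R := (j.+1%:R^-1)%R => c0 Ec.
  (* On [Z] the averages of h(K) tend to 0, although they dominate c times the frequency of visits
     to [E j]. *)
  suff : (c * fine ((mu w : probability S R) (E j)) <= 0)%R.
    by apply/negP; rewrite -ltNge mulr_gt0.
  have cl : (c * predR n w (E j))%R @[n --> \oo] --> (c * fine ((mu w : probability S R) (E j)))%R.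
    by apply: cvgM => //; exact: cvg_cst.
  (* The predictive probability of [E j] contains a prior term besides the frequency; it is added to
     both sides and vanishes in the limit. *)
  have cr : ((\sum_(i < n) h (K (X i w))) / (n%:R + theta) +
      c * (theta / (n%:R + theta) * fine (nu (E j))))%R @[n --> \oo] --> (0%R : R).
    rewrite -[X in _ --> X]addr0 -[X in _ --> (_ + X)%R](mulr0 c).
    apply: cvgD => //; apply: cvgM; first exact: cvg_cst.
    rewrite -[X in _ --> X](mul0r (fine (nu (E j)))).
    by apply: cvgM; [exact: cvg_theta_div|exact: cvg_cst].
  apply: (ler_cvg_to cl cr); apply: nearW => n.
  rewrite uw urn_mean_bits /smoothed_mean mulrDl mulrDr addrC.
  apply: lerD; last by rewrite (mulrAC theta).
  rewrite mulrA; apply: ler_wpM2r; first by rewrite invr_ge0 addr_ge0// ltW.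
  rewrite mulr_sumr; apply: ler_sum => i _; case: asboolP => hE; last by rewrite mulr0.
  by rewrite mulr1; exact: Ec.
move=> [N [mN N0 NZ]]; apply/eqP; rewrite eq_le measure_ge0 andbT -N0.
by apply: le_measure; rewrite ?inE// => w Zw; apply: NZ.
Qed.

End class_L.

(** * Borel subspaces of Polish spaces *)

(** Balls of radius 1 / (k + 1) around a countable dense set, transported from the metric copy, form
    a countable base; it separates points by the Hausdorff property. *)
Lemma polish_base (R : realType) (T : topologicalType) : polish R T ->
  exists U : nat -> set T, [/\ forall i, open (U i),
    forall O t, open O -> O t -> exists2 i, U i t & U i `<=` O &
    forall x y, (forall i, U i x <-> U i y) -> x = y].
Proof.
move=> [[C /countable_injP[j jinj] dC] [M [f [g [fK gK cf cg _]]]]].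
pose B (c : T) (k : nat) : set T := (f @^-1` ball (f c) (k.+1%:R^-1 : R))^°.
pose U i : set T := if unpickle i is Some (a, k) then
  [set t | exists c, [/\ C c, j c = a & B c k t]] else set0.
have oU i : open (U i).
  rewrite /U; case: unpickle => [[a k]|]; last exact: open0.
  rewrite (_ : [set t | _] = \bigcup_(c in [set c | C c /\ j c = a]) B c k).
    by apply: bigcup_open => c _; exact: open_interior.
  apply/seteqP; split => t; first by move=> [c [Cc jc Bt]]; exists c.
  by move=> [c [Cc jc] Bt]; exists c.
have nbf t (e : R) : 0 < e -> nbhs t (f @^-1` ball (f t) e).
  by move=> e0; apply: cf; exact: nbhsx_ballx.
have base O t : open O -> O t -> exists2 i, U i t & U i `<=` O.
  move=> oO Ot.
  have : nbhs (f t) (g @^-1` O) by apply: cg; rewrite fK; exact: open_nbhs_nbhs.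
  move=> /nbhs_ballP[e /= e0 He].
  have e2 : 0 < e / 2 by rewrite divr_gt0.
  have [k _ /(_ k (leqnn _)) /= ke] := near_infty_natSinv_lt (PosNum e2).
  (* With a centre within r / 2 of t, the ball of radius r contains t and lies within 3 r / 2 < e of
     it. *)
  set r : R := k.+1%:R^-1 in ke.
  have r0 : 0 < r by rewrite invr_gt0.
  have r2 : 0 < r / 2 by rewrite divr_gt0.
  have [c [ct Cc]] : (f @^-1` ball (f t) (r / 2))^° `&` C !=set0.
    apply: dC; last exact: open_interior.
    by exists t; exact: nbf.
  have {}ct := interior_subset ct.
  exists (pickle (j c, k)); rewrite /U pickleK.
    exists c; split => //.
    apply: filterS (nbf t _ r2) => s ts /=; rewrite -/r (splitr r).
    by apply: ball_triangle ts; exact: ball_sym.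
  move=> s [c' [Cc' jc' /interior_subset/= c's]].
  have ? : c' = c by apply: jinj; rewrite ?inE.
  subst c'; rewrite -(fK s); apply: He; apply: (@le_ball _ _ _ (r / 2 + r)).
    by rewrite /=; lra.
  exact: ball_triangle ct c's.
exists U; split => // x y xy.
rewrite -(fK x) -(fK y); congr g; apply: metric_hausdorff => V W Vx Wy.
exists (f y); split; last exact: nbhs_singleton.
have [i Ux UO] := base _ x (@open_interior _ (f @^-1` V)) (cf x V Vx).
exact: (interior_subset (UO _ ((xy i).1 Ux))).
Qed.

(** The traces of a countable base generate: every open set is the countable union of the base sets
    that it contains. *)
Lemma borel_space_generated (R : realType) (T : topologicalType) (S : set T) (x0 : S) :
  polish R T -> exists A : nat -> set (borel_space x0),
    countably_generated A /\ separating A.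
Proof.
move=> /polish_base[U [oU base sep]].
pose A i : set (borel_space x0) := [set x : S | U i (set_val x)].
exists A; split; last first.
  by move=> x y xy; apply: val_inj; exact: sep.
apply/seteqP; split; last first.
  apply: smallest_sub; first exact: smallest_sigma_algebra.
  by move=> _ [i _ <-]; apply: sub_sigma_algebra; exists (U i).
apply: smallest_sub; first exact: smallest_sigma_algebra.
move=> _ [V oV <-].
rewrite (_ : _ @^-1` _ = \bigcup_i (if `[< U i `<=` V >] then A i else set0)).
  apply: (@bigcupT_measurable _ (g_sigma_algebraType (range A))) => i.
  by case: ifP => _; [apply: sub_sigma_algebra; exists i|exact: measurable0].
apply/seteqP; split => x.
  move=> Vx; have [i Ui UO] := base V (set_val x) oV Vx.
  by exists i => //; rewrite asboolT.
by move=> [i _]; case: asboolP => // UO; exact: UO.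
Qed.

(** * The conclusions on a countably generated and separated space *)

Section class_L_directing.
Context (R : realType) (dO dS : measure_display).
Context (Omega : measurableType dO) (S : measurableType dS).
Context (P : probability Omega R) (X : nat -> {RV P >-> S}).
Context (nu : probability S R) (theta : R) (K : {mfun S >-> pprobability S R}).
Context (XL : in_class_L X nu theta K).
Context (mu : {RV P >-> pprobability S R}) (mulim : directing_measure X mu).
Context (A : nat -> set S) (genA : countably_generated A) (sepA : separating A).
Local Open Scope ereal_scope.

Lemma class_L_zero_one (D : set (pprobability S R)) :
  [set discrete_prob; nonatomic_prob; abs_cont_prob nu] D ->
  [/\ measurable [set w | D (mu w)],
      P [set w | D (mu w)] = 0 \/ P [set w | D (mu w)] = 1 &
      P [set w | D (mu w)] = 1 <-> {ae nu, forall x, D (K x)}].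
Proof.
have [theta0 [G sG KG] X0 predX] := XL.
have m1 := measurable_set1_generated genA sepA.
pose phi NN (p : pprobability S R) := fine (ideal_mass NN (p : probability S R)).
have phi0 NN : sigma_ideal NN -> forall p, (0 <= phi NN p)%R.
  by move=> idN p; rewrite fine_ge0// ideal_mass_ge0.
have phiE NN (idN : sigma_ideal NN) p (r : R) :
    ideal_mass NN (p : probability S R) = r%:E <-> phi NN p = r.
  by rewrite /phi; split => [->|<-]//; rewrite fineK// ideal_mass_fin.
have mphi NN : measurable_fun setT (fun p : pprobability S R => ideal_mass NN (p : probability S R)) ->
    measurable_fun setT (phi NN).
  by move=> mN; apply: (measurableT_comp (f := fine)) mN.
have lim NN (idN : sigma_ideal NN) := mass_mean_cvg theta0 sG KG X0 predX genA mulim idN.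
have zo := kernel_zero_one theta0 sG KG X0 predX mulim.
move=> [[->|->]|->].
- have idc := @sigma_ideal_countable _ S.
  (* Discreteness means that the countable mass is 1, so the zero-set criterion is applied to its
     complement to 1. *)
  apply: (zo (fun p => 1 - phi (@countable_ideal _ S) p)%R).
  + apply: measurable_funB => //; apply: mphi.
    exact: (measurable_countable_mass m1 genA sepA).
  + move=> p; rewrite subr_ge0 -lee_fin fineK ?ideal_mass_fin//.
    exact: ideal_mass_le1.
  + move=> p; split => [/discrete_probE/(phiE _ idc)->|/eqP]; first by rewrite subrr.
    by rewrite subr_eq0 eq_sym => /eqP/(phiE _ idc)/discrete_probE.
  apply: filterS (lim _ idc) => w cw.
  (* The constant 1 averages to n / (n + theta) = 1 - theta / (n + theta). *)
  have cv : (1 - theta / (n%:R + theta) -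
      (\sum_(i < n) phi (@countable_ideal _ S) (K (X i w))) / (n%:R + theta))%R
      @[n --> \oo] --> (1 - 0 - phi (@countable_ideal _ S) (mu w))%R.
    apply: cvgB => //; apply: cvgB; [exact: cvg_cst|exact: cvg_theta_div].
  rewrite subr0 in cv; rewrite (_ : (fun n => _) = (fun n => (1 - theta / (n%:R + theta) -
      (\sum_(i < n) phi (@countable_ideal _ S) (K (X i w))) / (n%:R + theta))%R))//.
  apply/funext => n; rewrite sumrB sumr_const card_ord mulrBl; congr (_ - _)%R.
  have n0 : (0 < n%:R + theta)%R by rewrite ltr_wpDl.
  by field; rewrite gt_eqF.
- have idc := @sigma_ideal_countable _ S.
  apply: (zo (phi (@countable_ideal _ S))).
  + by apply: mphi; exact: (measurable_countable_mass m1 genA sepA).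
  + exact: phi0.
  + by move=> p; rewrite nonatomic_probE//; exact: phiE.
  + exact: lim.
- have idn := sigma_ideal_null nu.
  apply: (zo (phi (null_ideal nu))).
  + by apply: mphi; exact: (measurable_null_mass genA).
  + exact: phi0.
  + by move=> p; rewrite abs_cont_probE; exact: phiE.
  + exact: lim.
Qed.

Lemma class_L_tv_cvg : {ae P, forall w,
  ereal_sup [set `| predictive nu theta K X n w B - (mu w : probability S R) B |
            | B in measurable] @[n --> \oo] --> 0}.
Proof.
have [theta0 [G sG KG] X0 predX] := XL.
exact: (predictive_tv_cvg theta0 sG KG X0 predX genA mulim).
Qed.

End class_L_directing.

Local Open Scope ereal_scope.

Theorem theorem10 (R : realType)
    (T : topologicalType) (polT : polish R T)
    (S : set T) (borS : <<s @open T >> S) (x0 : S)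
    (d : measure_display) (Omega : measurableType d) (P : probability Omega R)
    (X : nat -> {RV P >-> borel_space x0})
    (nu : probability (borel_space x0) R) (theta : R)
    (K : {mfun borel_space x0 >-> pprobability (borel_space x0) R})
    (XL : in_class_L X nu theta K)
    (mu : {RV P >-> pprobability (borel_space x0) R})
    (mulim : directing_measure X mu) :
  (forall D : set (pprobability (borel_space x0) R),
     [set discrete_prob; nonatomic_prob; abs_cont_prob nu] D ->
     [/\ measurable [set w | D (mu w)],
         P [set w | D (mu w)] = 0 \/ P [set w | D (mu w)] = 1 &
         P [set w | D (mu w)] = 1 <-> {ae nu, forall x, D (K x)}])
  /\ {ae P, forall w,
       ereal_sup [set `| predictive nu theta K X n w A
                         - (mu w : probability _ R) A |
                 | A in measurable] @[n --> \oo] --> 0}.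
Proof.
have [A [genA sepA]] := borel_space_generated x0 polT.
split; last exact: (class_L_tv_cvg XL mulim genA).
by move=> D; exact: (class_L_zero_one XL mulim genA sepA).
Qed.
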